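(* Fix $m,n\in\mathbb{N}$. For every symmetric compact set $K\subseteq\mathbb{R}^m$ and every unit vector $\theta$ in $\mathbb{R}^n$, we have $$\big| \mathrm{Proj}_{H_\theta}(K^n)\big| \geq |K|^{n-1}.$$
   Context: A set $K\subseteq\mathbb{R}^m$ is symmetric if $K=-K$. $K^n\subseteq(\mathbb{R}^m)^n=\mathbb{R}^{mn}$ is the $n$-fold Cartesian product. For a unit vector $\theta=(\theta_1,\ldots,\theta_n)\in\mathbb{R}^n$ (Euclidean norm), $H_\theta=\{(x_1,\ldots,x_n)\in(\mathbb{R}^m)^n:\ \sum_{i=1}^n\theta_i x_i=0\}$, a subspace of dimension $m(n-1)$. $\mathrm{Proj}_{H_\theta}$ is the orthogonal projection of $\mathbb{R}^{mn}$ onto $H_\theta$. $|\cdot|$ denotes Lebesgue measure of the appropriate dimension ($m$-dimensional for $K$; $m(n-1)$-dimensional on $H_\theta$ with the Euclidean structure induced from $\mathbb{R}^{mn}$, where a point has measure $1$ in dimension $0$).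
   Formalization: When n = 1 the set K is assumed nonempty: for n = 1 and K empty the stated inequality would read 0 ≥ |K|^0 = 1, which is false. *)

(* Defs.v *)
From HB Require Import structures.
From mathcomp Require Import all_boot all_order all_algebra.
From mathcomp Require Import all_classical all_reals all_analysis.
From mathcomp Require Import ring.

Set Implicit Arguments.
Unset Strict Implicit.
Unset Printing Implicit Defensive.

Import Order.TTheory GRing.Theory Num.Theory.
Import numFieldNormedType.Exports.

Local Open Scope classical_set_scope.
Local Open Scope ring_scope.

Section lebesgue_tuple.
Context {R : realType}.
Local Notation RT := (measurableTypeR R).

Definition consT k (p : RT * k.-tuple RT) : k.+1.-tuple RT :=
  [the k.+1.-tuple RT of p.1 :: p.2].

Lemma measurable_consT k : measurable_fun setT (@consT k).
Proof. exact: measurable_cons. Qed.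

HB.instance Definition _ k :=
  isMeasurableFun.Build _ _ _ _ (@consT k) (@measurable_consT k).

Section step.
Variables (k : nat) (mu : {sigma_finite_measure set (k.-tuple RT) -> \bar R}).

Definition lebesgue_step : set (k.+1.-tuple RT) -> \bar R :=
  pushforward ((@lebesgue_measure R) \x mu)%E (@consT k).

Let lebesgue_step0 : lebesgue_step set0 = 0%E.
Proof. exact: measure0. Qed.

Let lebesgue_step_ge0 A : (0 <= lebesgue_step A)%E.
Proof. exact: measure_ge0. Qed.

Let lebesgue_step_sigma_additive : semi_sigma_additive lebesgue_step.
Proof. exact: measure_semi_sigma_additive. Qed.

HB.instance Definition _ := isMeasure.Build _ _ _ lebesgue_step
  lebesgue_step0 lebesgue_step_ge0 lebesgue_step_sigma_additive.

Let lebesgue_step_sigma_finite : sigma_finite setT lebesgue_step.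
Proof.
have /sigma_finiteP[F [TF ndF Foo]] := sigma_finiteT (@lebesgue_measure R).
have /sigma_finiteP[G [TG ndG Goo]] := sigma_finiteT mu.
pose g (t : k.+1.-tuple RT) : RT * k.-tuple RT :=
  (thead t, [tuple of behead t]).
have mg : measurable_fun setT g.
  apply/measurable_fun_pair => /=; first exact: measurable_tnth.
  exact: measurable_behead.
have gK : cancel (@consT k) g.
  by case=> x t; congr pair; apply/val_inj.
exists (fun i => g @^-1` (F i `*` G i)).
  apply/esym; rewrite -subTset => t _.
  have [i _ Fi] : (\bigcup_i F i) (g t).1 by rewrite -TF.
  have [j _ Gj] : (\bigcup_i G i) (g t).2 by rewrite -TG.
  exists (maxn i j) => //; split => /=.
    by have /subsetPset := ndF _ _ (leq_maxl i j); apply.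
  by have /subsetPset := ndG _ _ (leq_maxr i j); apply.
move=> i; have [mF Fi] := Foo i; have [mG Gi] := Goo i; split.
  by rewrite -[X in measurable X]setTI; apply: mg => //; exact: measurableX.
rewrite /lebesgue_step /pushforward -comp_preimage.
rewrite (_ : g \o @consT k = id); last by apply/funext => p /=; rewrite gK.
by rewrite preimage_id product_measure1E// lte_mul_pinfty// ge0_fin_numE.
Qed.

HB.instance Definition _ := Measure_isSigmaFinite.Build _ _ _ lebesgue_step
  lebesgue_step_sigma_finite.

End step.

Section zero.
Definition lebesgue_zero : set (0.-tuple RT) -> \bar R := \d_([tuple] : 0.-tuple RT).
HB.instance Definition _ := Measure.on lebesgue_zero.
Let lebesgue_zero_sigma_finite : sigma_finite setT lebesgue_zero.
Proof.
exists (fun=> setT); first by rewrite bigcup_const//; exists 0%N.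
by move=> _; split => //; rewrite /lebesgue_zero diracT ltry.
Qed.
HB.instance Definition _ := Measure_isSigmaFinite.Build _ _ _ lebesgue_zero
  lebesgue_zero_sigma_finite.
End zero.

(* k-dimensional Lebesgue measure on Borel sets, as the k-fold product of
   [lebesgue_measure]; in dimension 0 it is the Dirac mass at the only point. *)
Fixpoint lebesgue_tuple k : {sigma_finite_measure set (k.-tuple RT) -> \bar R} :=
  match k with
  | 0 => lebesgue_zero
  | k'.+1 => lebesgue_step (lebesgue_tuple k')
  end.

Lemma lebesgue_tuple_box k (A : 'I_k -> set RT) :
  (forall i, measurable (A i)) ->
  lebesgue_tuple k [set t | forall i, A i (tnth t i)] =
  (\prod_(i < k) lebesgue_measure (A i))%E.
Proof.
elim: k A => [|k IH] A mA.
  rewrite big_ord0 /= /lebesgue_zero diracE mem_set//=.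
  by case.
rewrite big_ord_recl /= /lebesgue_step /pushforward.
set B := [set t : k.-tuple RT | forall i, A (lift ord0 i) (tnth t i)].
have mB : measurable B.
  rewrite (_ : B = \bigcap_(i in [set: 'I_k])
      ((fun t : k.-tuple RT => tnth t i) @^-1` A (lift ord0 i))).
    apply: fin_bigcap_measurable => // i _.
    by rewrite -[X in measurable X]setTI; exact: measurable_tnth.
  by apply/seteqP; split => [t Bt i _|t Bt i]; [exact: Bt|exact: (Bt i I)].
rewrite -(IH (fun i => A (lift ord0 i)))// -/B.
rewrite (_ : _ @^-1` _ = A ord0 `*` B) ?product_measure1E//.
apply/seteqP; split => [[x t] /= h|[x t] /= [h0 h] i].
  by split; [exact: (h ord0)|move=> i; have := h (lift ord0 i); rewrite tnthS].
have [j ->|->//] := unliftP ord0 i.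
by rewrite tnthS; exact: h.
Qed.

End lebesgue_tuple.

(* The library's measurable structure lives on tuples, its topology on row
   vectors; the two copies of R^k are identified coordinatewise. *)
Definition lebesgue_rV {R : realType} k (A : set 'rV[R]_k) : \bar R :=
  lebesgue_tuple k [set t | A (\row_i tnth t i)].

(* A point (x_1, ..., x_n) of (R^m)^n is the n x m matrix whose rows are the
   x_i. *)
Section euclidean.
Context {R : realType} {n m : nat}.
Implicit Types (X Y P : 'M[R]_(n, m)) (H : set 'M[R]_(n, m)).

Definition inner X Y : R := \sum_i \sum_j X i j * Y i j.

(* The library's norm `|X| on matrices is the sup norm, hence this one. *)
Definition enorm X : R := Num.sqrt (inner X X).

Definition is_orthoproj H X P :=
  H P /\ forall Y, H Y -> inner (X - P) Y = 0.

(* The default value 0 is never used for the subspaces [Hsub theta] with theta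
   a unit vector, see [orthoproj_Hsub]. *)
Definition orthoproj H X : 'M[R]_(n, m) := xget 0 (is_orthoproj H X).

Definition frame k (e : 'I_k -> 'M[R]_(n, m)) (t : 'rV[R]_k) : 'M[R]_(n, m) :=
  \sum_a t 0 a *: e a.

Definition orthonormal_basis k H (e : 'I_k -> 'M[R]_(n, m)) :=
  (forall a b, inner (e a) (e b) = (a == b)%:R) /\ H = range (frame e).

(* k-dimensional Lebesgue measure on the k-dimensional subspace H with the
   induced Euclidean structure: the Lebesgue measure of the set of coordinates
   in an orthonormal basis of H. The value does not depend on the basis, by
   rotation invariance; [orthonormal_basis_Hsub] shows that for [Hsub theta]
   the default of [xget] is not used. *)
Definition lebesgue_subspace k H (A : set 'M[R]_(n, m)) : \bar R :=
  lebesgue_rV (frame (xget (fun=> 0) (@orthonormal_basis k H)) @^-1` A).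

Definition Hsub (theta : 'rV[R]_n) : set 'M[R]_(n, m) :=
  [set X | \sum_i theta 0 i *: row i X = 0].

Definition cartesian_power (K : set 'rV[R]_m) : set 'M[R]_(n, m) :=
  [set X | forall i, K (row i X)].

Lemma innerE X Y : inner X Y = \tr (X *m Y^T).
Proof.
by apply: eq_bigr => i _; rewrite mxE; apply: eq_bigr => j _; rewrite mxE.
Qed.

End euclidean.

Section Hsub_theory.
Context {R : realType}.

Lemma HsubE n m (theta : 'rV[R]_n) (X : 'M[R]_(n, m)) :
  Hsub theta X <-> theta *m X = 0.
Proof. by rewrite mulmx_sum_row. Qed.

Lemma enorm1P n (theta : 'rV[R]_n) :
  enorm theta = 1 -> theta *m theta^T = 1%:M.
Proof.
move=> h; have : inner theta theta = 1.
  rewrite -[LHS]sqr_sqrtr; first by rewrite -/(enorm theta) h expr1n.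
  by apply: sumr_ge0 => i _; apply: sumr_ge0 => j _; rewrite -expr2 sqr_ge0.
by rewrite innerE trace_mx11 => e; rewrite [LHS]mx11_scalar e.
Qed.

Lemma innerBl n m (X Y Z : 'M[R]_(n, m)) :
  inner (X - Y) Z = inner X Z - inner Y Z.
Proof. by rewrite !innerE mulmxBl raddfB. Qed.

Lemma inner_eq0 n m (X : 'M[R]_(n, m)) : inner X X = 0 -> X = 0.
Proof.
move=> X0; apply/matrixP => i j; rewrite mxE; apply/eqP.
have ge0 a b : 0 <= X a b * X a b by rewrite -expr2 sqr_ge0.
move: X0 => /psumr_eq0P => /(_ (fun a _ => sumr_ge0 _ (fun b _ => ge0 a b))).
move=> /(_ i isT)/psumr_eq0P => /(_ (fun b _ => ge0 i b))/(_ j isT)/eqP.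
by rewrite mulf_eq0 orbb.
Qed.

Lemma is_orthoproj_uniq n m (H : set 'M[R]_(n, m)) X P Q :
  (forall A B, H A -> H B -> H (A - B)) ->
  is_orthoproj H X P -> is_orthoproj H X Q -> P = Q.
Proof.
move=> HB [HP hP] [HQ hQ]; apply/subr0_eq/inner_eq0.
rewrite [X in inner X _](_ : _ = (X - Q) - (X - P)).
  by rewrite innerBl hQ ?hP ?subr0 //; exact: HB.
by rewrite [RHS]addrC opprB addrA subrK.
Qed.

Lemma orthoproj_Hsub n m (theta : 'rV[R]_n) (X : 'M[R]_(n, m)) :
  enorm theta = 1 ->
  orthoproj (Hsub theta) X = X - theta^T *m (theta *m X).
Proof.
move=> /enorm1P theta1.
have HP : is_orthoproj (Hsub theta) X (X - theta^T *m (theta *m X)).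
  split.
    by apply/HsubE; rewrite mulmxBr (mulmxA theta) theta1 mul1mx subrr.
  move=> Y /HsubE thetaY.
  rewrite subKr innerE -mulmxA mxtrace_mulC -!mulmxA.
  by rewrite -trmx_mul thetaY trmx0 !mulmx0 mxtrace0.
apply: (is_orthoproj_uniq _ _ HP); last exact: (xgetI _ HP).
move=> A B /HsubE hA /HsubE hB.
by apply/HsubE; rewrite mulmxBr hA hB subrr.
Qed.

Lemma orthogonal_completion n (theta : 'rV[R]_n.+1) :
  theta *m theta^T = 1%:M ->
  exists2 Q : 'M[R]_n.+1, Q *m Q^T = 1%:M & row ord0 Q = theta.
Proof.
move=> theta1; pose d : 'rV[R]_n.+1 := delta_mx 0 ord0.
have dd : d *m d^T = 1%:M.
  by rewrite trmx_delta mul_delta_mx; apply/matrixP => i j; rewrite !ord1 !mxE.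
have [v0|v0] := eqVneq (theta - d) 0.
  exists 1%:M; first by rewrite trmx1 mulmx1.
  by rewrite row1; apply/esym/subr0_eq.
set v := theta - d in v0.
pose c := inner v v.
have vv : v *m v^T = c%:M by rewrite /c innerE trace_mx11 -mx11_scalar.
have c0 : c != 0 by apply: contra_neq v0; exact: inner_eq0.
pose a := (d *m theta^T) 0 0.
have da : d *m theta^T = a%:M by exact: mx11_scalar.
have ad : theta *m d^T = a%:M.
  by rewrite -[LHS]trmxK trmx_mul trmxK da tr_scalar_mx.
have cE : c = 2 * (1 - a).
  have : c%:M = (2 * (1 - a))%:M :> 'M[R]_1.
    rewrite -vv /v linearB /= mulmxBl !mulmxBr theta1 dd da ad.
    by apply/matrixP => i j; rewrite !ord1 !mxE/= !mulr1n; ring.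
  by move/matrixP => /(_ 0 0); rewrite !mxE/= !mulr1n.
have dv : d *m v^T = (a - 1)%:M.
  by rewrite /v linearB /= mulmxBr da dd [RHS]raddfB.
pose Q := 1%:M - (2 / c) *: (v^T *m v).
have QT : Q^T = Q.
  by rewrite /Q linearB /= trmx1 linearZ /= trmx_mul trmxK.
exists Q.
  have : (v^T *m v) *m (v^T *m v) = c *: (v^T *m v).
    by rewrite -mulmxA (mulmxA v) vv mul_scalar_mx -scalemxAr.
  rewrite QT /Q; move: (v^T *m v) => M MM.
  rewrite mulmxBl mul1mx mulmxBr mulmx1 -!scalemxAl -!scalemxAr MM !scalerA.
  apply/matrixP => i j; rewrite !mxE; move: (_ *+ _) (M i j) => x y.
  by field.
rewrite rowE -/d /Q mulmxBr mulmx1 -scalemxAr mulmxA dv mul_scalar_mx scalerA.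
have -> : 2 / c * (a - 1) = -1.
  rewrite -[a - 1]opprB mulrN; congr (- _).
  by rewrite mulrAC -cE divff.
by rewrite scaleN1r opprK /v addrC subrK.
Qed.

Lemma orthonormal_basis_Hsub n m (theta : 'rV[R]_n) :
  enorm theta = 1 ->
  exists e : 'I_(m * n.-1) -> 'M[R]_(n, m), orthonormal_basis (Hsub theta) e.
Proof.
move=> /enorm1P; case: n theta => [|n] theta theta1.
  have := congr1 (fun M : 'M[R]_1 => M 0 0) theta1.
  by rewrite !mxE big_ord0 => /eqP; rewrite eq_sym oner_eq0.
have [Q QQ Q0] := orthogonal_completion theta1.
pose W : 'M[R]_(n, n.+1) := row' ord0 Q.
have WW : W *m W^T = 1%:M.
  apply/matrixP => i j; have /matrixP/(_ (lift ord0 i) (lift ord0 j)) := QQ.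
  rewrite !mxE (inj_eq lift_inj) => <-.
  by apply: eq_bigr => k _; rewrite !mxE.
have tW : theta *m W^T = 0.
  apply/matrixP => i j; transitivity ((Q *m Q^T) ord0 (lift ord0 j)).
    rewrite -Q0 !mxE; by apply: eq_bigr => k _; rewrite !mxE.
  by rewrite QQ !mxE.
have QtQ : theta^T *m theta + W^T *m W = 1%:M.
  rewrite -(mulmx1C QQ) -Q0; apply/matrixP => i j.
  rewrite !mxE [RHS]big_ord_recl big_ord1 !mxE; congr (_ + _).
  by apply: eq_bigr => k _; rewrite !mxE.
pose E (t : 'rV[R]_(m * n)) : 'M[R]_(n.+1, m) := W^T *m (vec_mx t)^T.
pose e (c : 'I_(m * n)) := E (delta_mx 0 c).
have frameE t : frame e t = E t.
  rewrite /frame /E {2}(row_sum_delta t) linear_sum /= linear_sum /= mulmx_sumr.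
  by apply: eq_bigr => c _; rewrite linearZ /= linearZ /= -scalemxAr.
exists e; split.
  move=> a b; rewrite innerE /e /E trmx_mul !trmxK mxtrace_mulC.
  rewrite -mulmxA (mulmxA W) WW mul1mx.
  case/mxvec_indexP: a => i j; case/mxvec_indexP: b => i' j'.
  rewrite !vec_mx_delta trmx_delta mul_delta_mx_cond.
  rewrite /mxvec_index (inj_eq (@cast_ord_inj _ _ _)) (inj_eq enum_rank_inj).
  rewrite xpair_eqE raddfMn /= /mxtrace (bigD1 i') //= big1 => [|k ki'].
    by rewrite mxE eqxx /= addr0 -mulrnA mulnb (eq_sym i') (eq_sym j').
  by rewrite mxE (negbTE ki').
apply/seteqP; split => [X /HsubE tX|_ [t _ <-]].
  exists (mxvec (W *m X)^T) => //; rewrite frameE /E mxvecK trmxK mulmxA.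
  by rewrite -[RHS]mul1mx -QtQ mulmxDl -(mulmxA theta^T) tX mulmx0 add0r.
by apply/HsubE; rewrite frameE /E mulmxA tW mul0mx.
Qed.

End Hsub_theory.

(* Main.v *)
Require Import Defs.
From mathcomp Require Import all_boot all_order all_algebra.
From mathcomp Require Import all_classical all_reals all_analysis.
From mathcomp Require Import measurable_realfun ring lra.

(* This is a case of Barthe's reverse Brascamp-Lieb inequality.  Let W be a matrix
   whose rows form an orthonormal basis of theta^perp, so that x |-> W x stands for
   the projection along theta, and put c_i = 1 - theta_i^2, so that sum c_i = n - 1.

   Dimension one, functional form: let f_1, ..., f_n be step functions and let h
   satisfy h (W x) >= prod f_i (x_i)^c_i.  The increasing map T_i transports the
   uniform density of an interval of length 1 to f_i / int f_i; as W T(u) = W T(u')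
   with u - u' in theta^perp forces (T(u) - T(u')) . (u - u') = 0, the map
   y |-> W T(W^T y + c theta) is injective.  It is piecewise affine with Jacobian
   det (W diag(t) W^T) = (prod t_i) (sum theta_i^2 / t_i) >= prod t_i^c_i, by the
   weighted AM-GM inequality.  Hence int h >= V(c) prod (int f_i)^c_i, where V(c)
   is the volume of the section of the unit cube by <theta, x> = c.  Some V(c)
   exceeds any M < 1, because V is a probability density of variance 1/12.

   Integrating out one coordinate of R^m at a time gives the inequality for unions
   of grid cubes; a compact set is a limit of such unions from outside. *)

Set Implicit Arguments.
Unset Strict Implicit.
Unset Printing Implicit Defensive.

Import Order.TTheory GRing.Theory Num.Theory.
Import numFieldNormedType.Exports.

Local Open Scope classical_set_scope.
Local Open Scope ring_scope.

(** * Linear changes of variables *)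

Section tonelli_tuple.
Context {R : realType}.
Local Notation RT := (measurableTypeR R).
Local Notation leb := (@lebesgue_measure R).
Local Notation lam k := (@lebesgue_tuple R k).
Local Open Scope ereal_scope.

Lemma measurable_fun_consT k d (T : measurableType d) (f : T -> RT)
    (g : T -> k.-tuple RT) :
  measurable_fun setT f -> measurable_fun setT g ->
  measurable_fun setT (fun x => consT (f x, g x)).
Proof. by move=> mf mg; exact: measurable_cons. Qed.

Section tonelli.
Variables (k : nat) (F : k.+1.-tuple RT -> \bar R).
Hypotheses (mF : measurable_fun [set: k.+1.-tuple RT] F) (F0 : forall t, 0 <= F t).

Let mFc : measurable_fun setT (F \o @consT R k).
Proof. by apply: measurableT_comp => //; exact: measurable_consT. Qed.

Lemma integral_lebesgue_tupleS :
  \int[lam k.+1]_t F t = \int[leb]_x \int[lam k]_t F (consT (x, t)).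
Proof.
rewrite [LHS](ge0_integral_pushforward (@measurable_consT R k))//=.
by rewrite preimage_setT fubini_tonelli1.
Qed.

Lemma integral_lebesgue_tupleSr :
  \int[lam k.+1]_t F t = \int[lam k]_t \int[leb]_x F (consT (x, t)).
Proof.
rewrite [LHS](ge0_integral_pushforward (@measurable_consT R k))//=.
by rewrite preimage_setT fubini_tonelli2.
Qed.

Lemma measurable_integral_lebesgue_tuple :
  measurable_fun setT (fun x : RT => \int[lam k]_t F (consT (x, t))).
Proof.
exact: (measurable_fun_fubini_tonelli_F (m2 := lam k) _ mFc (fun=> F0 _)).
Qed.

Lemma measurable_integral_lebesgue_tupler :
  measurable_fun setT (fun t => \int[leb]_x F (consT (x, t))).
Proof.
exact: (measurable_fun_fubini_tonelli_G (m1 := leb) _ mFc (fun=> F0 _)).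
Qed.

End tonelli.

(** The Lebesgue measure is determined by its values on half-open intervals, so the pushforward
    scaled by [|a|] only has to be computed there. For a < 0 the preimage of []x, y]] is closed on
    the left and open on the right. *)
Lemma lebesgue_measure_affine (a b : R) (A : set RT) : a != 0%R ->
  measurable A ->
  leb ((fun x : RT => (a * x + b)%R : RT) @^-1` A) = `|a|^-1%:E * leb A.
Proof.
move=> a0 mA; pose f := fun x : RT => (a * x + b)%R : RT.
have mf : measurable_fun [set: RT] f.
  by apply: measurable_funD => //; exact: measurable_funM.
have na : (0 <= `|a|)%R by [].
rewrite -[LHS]/(pushforward leb f A).
suff -> : leb A = pushforward (mscale (NngNum na) leb) f A.
  by rewrite /pushforward /mscale muleA -EFinM mulVf ?mul1e// normr_eq0.
apply: (lebesgue_measure_unique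
  (mu := pushforward (mscale (NngNum na) leb) f)) => // _ [[x y]] _ <-.
rewrite /= /pushforward /mscale lebesgue_measure_itv/= lte_fin.
have [a_gt0|a_lt0|/eqP] := ltgtP 0%R a; last by rewrite eq_sym (negbTE a0).
- rewrite (_ : _ @^-1` _ = `]((x - b) / a)%R, ((y - b) / a)%R]%classic); last first.
    apply/seteqP; split=> z /=; rewrite !in_itv/= /f.
      by rewrite ltr_pdivrMr// ler_pdivlMr// ltrBlDr lerBrDr mulrC.
    by rewrite ltr_pdivrMr// ler_pdivlMr// ltrBlDr lerBrDr mulrC.
  rewrite lebesgue_measure_itv/= lte_fin ltr_pM2r ?invr_gt0// ltrD2r.
  case: ifPn => _; last by rewrite mule0.
  by rewrite -!EFinB -EFinM -mulrBl gtr0_norm// mulrCA divff// mulr1;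
    congr EFin; lra.
- rewrite (_ : _ @^-1` _ = `[((y - b) / a)%R, ((x - b) / a)%R[%classic); last first.
    apply/seteqP; split=> z /=; rewrite !in_itv/= /f.
      by rewrite ler_ndivrMr// ltr_ndivlMr// ltrBlDr lerBrDr mulrC andbC.
    by rewrite ler_ndivrMr// ltr_ndivlMr// ltrBlDr lerBrDr mulrC andbC.
  rewrite lebesgue_measure_itv/= lte_fin ltr_nM2r ?invr_lt0// ltrD2r.
  case: ifPn => _; last by rewrite mule0.
  by rewrite -!EFinB -EFinM -mulrBl ltr0_norm// mulNr mulrCA divff// mulr1;
    congr EFin; lra.
Qed.

Lemma integral_affine (a b : R) (f : RT -> \bar R) : a != 0%R ->
  measurable_fun [set: RT] f -> (forall x, 0 <= f x) ->
  \int[leb]_x f (a * x + b)%R = `|a|^-1%:E * \int[leb]_x f x.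
Proof.
move=> a0 mf f0; pose g := fun x : RT => (a * x + b)%R : RT.
have mg : measurable_fun [set: RT] g.
  by apply: measurable_funD => //; exact: measurable_funM.
have na : (0 <= `|a|^-1)%R by rewrite invr_ge0.
rewrite -(ge0_integral_mscale leb measurableT (NngNum na))//.
transitivity (\int[pushforward leb g]_x f x).
  by rewrite ge0_integral_pushforward// preimage_setT.
by apply: eq_measure_integral => A mA _; exact: lebesgue_measure_affine.
Qed.

End tonelli_tuple.

Section affine_maps.
Context {R : realType}.
Local Notation RT := (measurableTypeR R).
Local Notation leb := (@lebesgue_measure R).
Local Notation lam k := (@lebesgue_tuple R k).

Definition row_of_tuple k (t : k.-tuple RT) : 'rV[R]_k := (\row_i tnth t i).
Definition tuple_of_row k (v : 'rV[R]_k) : k.-tuple RT :=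
  [tuple (v ord0 i : RT) | i < k].

Lemma row_of_tupleK k : cancel (@row_of_tuple k) (@tuple_of_row k).
Proof.
by move=> t; apply: eq_from_tnth => i; rewrite tnth_mktuple mxE.
Qed.

Lemma tuple_of_rowK k : cancel (@tuple_of_row k) (@row_of_tuple k).
Proof. by move=> v; apply/rowP => i; rewrite mxE tnth_mktuple. Qed.

Definition affine k l (M : 'M[R]_(k, l)) (b : 'rV[R]_l) (t : k.-tuple RT) :
  l.-tuple RT := tuple_of_row (row_of_tuple t *m M + b).

Lemma measurable_affine k l (M : 'M[R]_(k, l)) (b : 'rV[R]_l) :
  measurable_fun [set: k.-tuple RT] (affine M b).
Proof.
apply/measurable_fun_tnthP => i.
rewrite (_ : _ \o _ = fun t => (\sum_j tnth t j * M j i + b ord0 i) : RT).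
  apply: measurable_funD => //; apply: measurable_sum => j.
  by apply: measurable_funM => //; exact: measurable_tnth.
apply/funext => t /=; rewrite tnth_mktuple !mxE; congr (_ + _).
by apply: eq_bigr => j _; rewrite mxE.
Qed.

Lemma affine_mulmx k l p (A : 'M[R]_(k, l)) (B : 'M[R]_(l, p)) b c t :
  affine (A *m B) (b *m B + c) t = affine B c (affine A b t).
Proof. by rewrite /affine tuple_of_rowK mulmxDl mulmxA addrA. Qed.

Lemma row_of_consT k (x : RT) (t : k.-tuple RT) :
  row_of_tuple (consT (x, t)) =
    row_mx (x%:M : 'rV_1) (row_of_tuple t) :> 'rV[R]_(1 + k).
Proof.
apply/rowP => i; rewrite mxE.
case: (@split_ordP 1 k i) => j ->.
  rewrite row_mxEl mxE ord1 /= mulr1n (_ : lshift k ord0 = ord0)//.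
  by apply/val_inj.
rewrite row_mxEr mxE (_ : rshift 1 j = lift ord0 j) ?tnthS//.
by apply/val_inj.
Qed.

Lemma tuple_of_row_mx k (u : 'rV[R]_1) (v : 'rV[R]_k) :
  tuple_of_row (row_mx u v : 'rV[R]_(1 + k)) =
    consT (u ord0 ord0 : RT, tuple_of_row v).
Proof.
apply: (can_inj (@row_of_tupleK _)); rewrite tuple_of_rowK row_of_consT.
by rewrite tuple_of_rowK -mx11_scalar.
Qed.

Lemma mulmx_tr_eq0 k l p (A : 'M[R]_(k, p)) (B : 'M[R]_(l, p)) :
  A *m B^T = 0 -> B *m A^T = 0.
Proof. by move=> AB; rewrite -[LHS]trmxK trmx_mul trmxK AB trmx0. Qed.

Lemma normr_det_orthogonal k (M : 'M[R]_k) : M *m M^T = 1%:M -> `|\det M| = 1.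
Proof.
move=> /(congr1 determinant); rewrite det_mulmx det_tr det1 -expr2 => /eqP.
by rewrite sqrf_eq1 => /orP[] /eqP ->; rewrite ?normrN normr1.
Qed.

Lemma sum_sqr_unit k (v : 'rV[R]_k) : v *m v^T = 1%:M -> \sum_i v ord0 i ^+ 2 = 1.
Proof.
move=> /(congr1 (fun M : 'M[R]_1 => M ord0 ord0)); rewrite !mxE eqxx => vv.
by rewrite -[RHS]/(true%:R) -vv; apply: eq_bigr => i _; rewrite mxE expr2.
Qed.

(** Change of variables with factor [r], uniform in the translation [b]: integrating out a
    coordinate leaves a map whose translation depends on that coordinate. *)
Definition rescales k (M : 'M[R]_k) (r : R) := forall (b : 'rV[R]_k)
  (f : k.-tuple RT -> \bar R),
  measurable_fun [set: k.-tuple RT] f -> (forall t, 0 <= f t)%E ->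
  (\int[lam k]_t f (affine M b t) = r%:E * \int[lam k]_t f t)%E.

Lemma rescales_mulmx k (M N : 'M[R]_k) r s :
  rescales M r -> rescales N s -> rescales (M *m N) (r * s).
Proof.
move=> Mr Ns b f mf f0.
transitivity (\int[lam k]_t f (affine N b (affine M 0%R t)))%E.
  by apply: eq_integral => t _; rewrite -affine_mulmx mul0mx add0r.
rewrite (Mr 0 (fun t => f (affine N b t)))//; last first.
  by apply: (measurableT_comp mf); exact: measurable_affine.
by rewrite Ns// muleA EFinM.
Qed.

Lemma affine_block k (a : R) (b : 'rV[R]_k) c N (u : 'rV_1) v (x : RT) t :
  affine (block_mx a%:M b c N : 'M[R]_(1 + k)) (row_mx u v) (consT (x, t)) =
  consT ((a * x + ((row_of_tuple t *m c) + u) ord0 ord0) : RT,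
         affine N (x *: b + v) t).
Proof.
rewrite /affine row_of_consT mul_row_block add_row_mx tuple_of_row_mx.
congr (consT (_, tuple_of_row _)).
  by rewrite !mxE big_ord1 !mxE /= !mulr1n mulrC addrA.
by rewrite mul_scalar_mx [X in X + v]addrC addrA.
Qed.

(** The first entry of the image of (x, t) does not involve t. For fixed x the integral over t
    contributes [r]; the integral over x then contributes [|a|^-1]. *)
Lemma rescales_upper k (a : R) (b : 'rV[R]_k) N r : a != 0 -> 0 <= r ->
  rescales N r -> rescales (block_mx a%:M b 0 N : 'M[R]_(1 + k)) (`|a|^-1 * r).
Proof.
move=> a0 r0 Nr v f mf f0.
have mf' : measurable_fun [set: (1 + k).-tuple RT]
   (fun t => f (affine (block_mx a%:M b 0 N) v t)).
  by apply: (measurableT_comp mf); exact: measurable_affine.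
rewrite integral_lebesgue_tupleS//.
pose G x := (r%:E * \int[lam k]_t f (consT (x, t)))%E.
have mG : measurable_fun [set: RT] G.
  by apply: measurable_funeM; exact: measurable_integral_lebesgue_tuple.
transitivity (\int[leb]_x G (a * x + (lsubmx (v : 'rV[R]_(1 + k))) ord0 ord0)%R)%E.
  apply: eq_integral => x _; rewrite /G.
  rewrite -(Nr (x *: b + rsubmx (v : 'rV[R]_(1 + k))) (fun t => f (consT (_, t))))//.
    apply: eq_integral => t _.
    by rewrite -{1}[v](@hsubmxK _ 1 1 k) affine_block mulmx0 add0r.
  by apply: (measurableT_comp mf); exact: measurable_fun_consT.
rewrite integral_affine//; last first.
  by move=> x; rewrite mule_ge0// integral_ge0.
rewrite EFinM -muleA ge0_integralZl//; last 2 first.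
- exact: measurable_integral_lebesgue_tuple.
- by move=> x _; rewrite integral_ge0.
by rewrite -integral_lebesgue_tupleS.
Qed.

(** In the opposite order: for fixed t the first entry is x plus a shift depending on t, which the
    integral over x does not see. A translation in t remains. *)
Lemma rescales_lower k (c : 'cV[R]_k) : rescales (1%:M : 'M[R]_k) 1 ->
  rescales (block_mx 1%:M 0 c 1%:M : 'M[R]_(1 + k)) 1.
Proof.
move=> N1 v f mf f0; rewrite mul1e.
set M : 'M[R]_(1 + k) := block_mx _ _ _ _.
have mf' : measurable_fun [set: (1 + k).-tuple RT] (fun t => f (affine M v t)).
  by apply: (measurableT_comp mf); exact: measurable_affine.
rewrite integral_lebesgue_tupleSr//.
pose G t := (\int[leb]_x f (consT (x, t)))%E.
have mG : measurable_fun [set: k.-tuple RT] G.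
  exact: measurable_integral_lebesgue_tupler.
transitivity (\int[lam k]_t G (affine 1%:M (rsubmx (v : 'rV[R]_(1 + k))) t))%E.
  apply: eq_integral => t _; set w := lsubmx (v : 'rV[R]_(1 + k)).
  transitivity (\int[leb]_x f (consT ((1 * x + (row_of_tuple t *m c + w) ord0 ord0)%R : RT,
     affine 1%:M (rsubmx (v : 'rV[R]_(1 + k))) t)))%E.
    apply: eq_integral => x _.
    by rewrite /M -{1}[v](@hsubmxK _ 1 1 k) affine_block scaler0 add0r.
  rewrite (integral_affine _ (f := fun x => f (consT (x, _))))//.
    by rewrite normr1 invr1 mul1e.
  by apply: (measurableT_comp mf); exact: measurable_fun_consT.
rewrite N1//; last by move=> t; rewrite integral_ge0.
by rewrite mul1e -integral_lebesgue_tupleSr.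
Qed.

Lemma block_mx00 k l (a : 'M[R]_1) (b : 'M[R]_(1, l)) c (d : 'M[R]_(k, l)) :
  (block_mx a b c d : 'M[R]_(1 + k, 1 + l)) ord0 ord0 = a ord0 ord0.
Proof.
by rewrite -(block_mxEul a b c d); congr (block_mx a b c d _ _); exact/val_inj.
Qed.

(* After a shear making the upper left entry nonzero, [M] is a product of two
   block triangular matrices, each handled by integrating in one order. *)
Lemma rescales_unitmx k (M : 'M[R]_k) : M \in unitmx -> rescales M (`|\det M|^-1).
Proof.
elim: k M => [|k IH] M Mu.
  move=> b f mf f0; rewrite det_mx00 normr1 invr1 mul1e.
  by apply: eq_integral => t _; congr f; rewrite tuple0 [RHS]tuple0.
rewrite -[k.+1]/(1 + k)%N in M Mu *.
have up (a : R) (b : 'rV[R]_k) (N : 'M[R]_k) : a != 0 -> N \in unitmx ->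
    rescales (block_mx a%:M b 0 N : 'M[R]_(1 + k))
      (`|\det (block_mx a%:M b 0 N : 'M[R]_(1 + k))|^-1).
  move=> a0 Nu; rewrite det_ublock det_scalar1 normrM invfM.
  by apply: rescales_upper => //; exact: IH.
have one : rescales (1%:M : 'M[R]_k) 1.
  by have := IH 1%:M (unitmx1 _ _); rewrite det1 normr1 invr1.
have pivot (A : 'M[R]_(1 + k)) : A \in unitmx -> A ord0 ord0 != 0 ->
    rescales A (`|\det A|^-1).
  rewrite unitmxE -[A]submxK.
  move: (ulsubmx A) (ursubmx A) (dlsubmx A) (drsubmx A) => a b c N.
  rewrite [a]mx11_scalar; set al := a ord0 ord0.
  rewrite block_mx00 mxE mulr1n.
  (* Elimination below the pivot [al]; [N'] is the Schur complement. *)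
  pose L := block_mx 1%:M 0 (al^-1 *: c) 1%:M : 'M[R]_(1 + k).
  pose N' := N - (al^-1 *: c) *m b.
  pose U := block_mx al%:M b 0 N' : 'M[R]_(1 + k).
  move=> Au al0; have LU : block_mx al%:M b c N = L *m U.
    rewrite mulmx_block !mul0mx !mul1mx !addr0 mul_mx_scalar.
    by rewrite scalerA divff// scale1r addrC subrK.
  have detA : \det (block_mx al%:M b c N) = \det U.
    by rewrite LU det_mulmx det_lblock !det1 !mul1r.
  rewrite detA LU -[_^-1]mul1r; apply: rescales_mulmx.
    exact: rescales_lower.
  apply: up => //; move: Au.
  by rewrite detA det_ublock unitrM det_scalar1 -unitmxE => /andP[].
(* The first column of an invertible matrix is nonzero, so adding some other row to the first one,
   if need be, makes the upper left entry nonzero. *)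
have [e M1] : exists e : 'rV[R]_k,
    ((block_mx 1%:M e 0 1%:M : 'M[R]_(1 + k)) *m M) ord0 ord0 != 0.
  have [M0|M0] := eqVneq ((M : 'M[R]_(1 + k)) ord0 ord0) 0; last first.
    by exists 0; rewrite -scalar_mx_block mul1mx.
  have [i Mi] : exists i, M i ord0 != 0.
    apply/existsP; rewrite -negb_forall; apply: contraTN Mu => /forallP Mi.
    rewrite unitmxE (expand_det_col _ ord0) big1 ?unitr0// => i _.
    by rewrite (eqP (Mi i)) mul0r.
  have [j ij|i0] := unliftP ord0 i; last by rewrite i0 M0 eqxx in Mi.
  exists (delta_mx 0 j).
  rewrite -[M](@submxK _ 1 k 1 k) mulmx_block.
  rewrite block_mx00 mul1mx -rowE !mxE.
  rewrite (_ : lshift k ord0 = ord0); last by apply/val_inj.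
  rewrite (_ : rshift 1 j = i) ?M0 ?add0r//.
  by rewrite ij; apply/val_inj.
set E : 'M[R]_(1 + k) := block_mx _ _ _ _ in M1.
pose E' : 'M[R]_(1 + k) := block_mx 1%:M (- e) 0 1%:M.
have E'E : E' *m E = 1%:M.
  rewrite mulmx_block !mul0mx !mulmx0 !mul1mx !mulmx1 !add0r !addr0 addrN.
  by rewrite -scalar_mx_block.
have dE : \det E = 1 by rewrite det_ublock !det1 mul1r.
have dE' : \det E' = 1 by rewrite det_ublock !det1 mul1r.
rewrite -[M]mul1mx -E'E -mulmxA det_mulmx normrM invfM.
apply: rescales_mulmx; first by apply: up => //; exact: unitmx1.
apply: pivot => //.
by rewrite unitmx_mul Mu unitmxE dE unitr1.
Qed.

End affine_maps.

Section cat_tuples.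
Context {R : realType}.
Local Notation RT := (measurableTypeR R).
Local Notation lam k := (@lebesgue_tuple R k).
Local Open Scope ereal_scope.

Lemma measurable_cat_tuple a b d (T : measurableType d) (f : T -> a.-tuple RT)
    (g : T -> b.-tuple RT) :
  measurable_fun setT f -> measurable_fun setT g ->
  measurable_fun setT (fun x => cat_tuple (f x) (g x) : (a + b).-tuple RT).
Proof.
move=> mf mg; apply/measurable_fun_tnthP => i; case: (split_ordP i) => j ->.
  rewrite (_ : _ \o _ = fun x => tnth (f x) j).
    exact: ((measurable_fun_tnthP _).1 _ j).
  by apply/funext => x /=; rewrite tnth_lshift.
rewrite (_ : _ \o _ = fun x => tnth (g x) j).
  exact: ((measurable_fun_tnthP _).1 _ j).
by apply/funext => x /=; rewrite tnth_rshift.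
Qed.

Section integral.
Variables (a b : nat) (F : (a + b).-tuple RT -> \bar R).
Hypotheses (mF : measurable_fun [set: (a + b).-tuple RT] F)
  (F0 : forall t, 0 <= F t).

Lemma measurable_integral_cat_tuple : measurable_fun [set: a.-tuple RT]
  (fun s => \int[lam b]_t F (cat_tuple s t)).
Proof.
have mF' : measurable_fun setT
    (fun p : a.-tuple RT * b.-tuple RT => F (cat_tuple p.1 p.2)).
  by apply: (measurableT_comp mF); exact: measurable_cat_tuple.
exact: (measurable_fun_fubini_tonelli_F (m2 := lam b) _ mF' (fun=> F0 _)).
Qed.
End integral.

Lemma integral_cat_tuple a b (F : (a + b).-tuple RT -> \bar R) :
  measurable_fun [set: (a + b).-tuple RT] F -> (forall t, 0 <= F t) ->
  \int[lam (a + b)]_t F t = \int[lam a]_s \int[lam b]_t F (cat_tuple s t).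
Proof.
elim: a F => [|a IH] F mF F0.
  rewrite integral_dirac//=; last exact: measurable_integral_cat_tuple.
  rewrite diracT mul1e.
  by apply: eq_integral => t _; congr F; exact: val_inj.
have consA x (s : a.-tuple RT) t :
    cat_tuple (consT (x, s)) t = consT (x, cat_tuple s t) :> (a.+1 + b).-tuple RT.
  exact: val_inj.
rewrite [LHS]integral_lebesgue_tupleS//.
rewrite [RHS]integral_lebesgue_tupleS//; last 2 first.
- exact: measurable_integral_cat_tuple.
- by move=> t; exact: integral_ge0.
apply: eq_integral => x _; rewrite [LHS]IH//.
- apply: eq_integral => s _; apply: eq_integral => t _.
  by rewrite consA.
- by apply: (measurableT_comp mF); exact: measurable_fun_consT.
Qed.

End cat_tuples.

(** * Sections of the cube *)

Section cube.
Context {R : realType}.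
Local Notation RT := (measurableTypeR R).
Local Notation leb := (@lebesgue_measure R).
Local Notation lam k := (@lebesgue_tuple R k).

Lemma integral_itv_horner (p P : {poly R}) (a b : R) : a < b -> P^`() = p ->
  (\int[leb]_(x in `[a, b[) (p.[x])%:E = (P.[b] - P.[a])%:E)%E.
Proof.
move=> ab Pp; rewrite integral_itv_bndo_bndc; last first.
  apply/measurable_EFinP/measurable_funTS.
  by apply: (@continuous_measurable_fun R); exact: continuous_horner.
rewrite (continuous_FTC2 (F := horner P))//.
- by apply: continuous_subspaceT; exact: continuous_horner.
- split => //.
  + by apply: cvg_at_right_filter; exact: continuous_horner.
  + by apply: cvg_at_left_filter; exact: continuous_horner.
- by move=> x _; rewrite -derivE Pp.
Qed.

Let I : set R := `[- 2^-1, 2^-1[.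

Definition cubeI k (t : k.-tuple RT) : R := \prod_i \1_I (tnth t i).

Lemma measurable_prod_indic k (A : 'I_k -> set RT) :
  (forall i, measurable (A i)) ->
  measurable_fun [set: k.-tuple RT] (fun t => \prod_i (\1_(A i) (tnth t i) : R)).
Proof.
move=> mA; apply: measurable_prod => i _.
apply: (@measurableT_comp _ _ _ _ _ _ (\1_(A i) : RT -> RT)).
  exact: measurable_indic.
exact: measurable_tnth.
Qed.

Lemma measurable_cubeI k : measurable_fun [set: k.-tuple RT] (@cubeI k).
Proof. by apply: measurable_prod_indic => i; exact: measurable_itv. Qed.

Lemma cubeI_ge0 k (t : k.-tuple RT) : 0 <= cubeI t.
Proof. by apply: prodr_ge0 => i _; rewrite indicE. Qed.

Lemma integral_indicM (A : set RT) (f : RT -> R) :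
  (\int[leb]_x (\1_A x * f x)%:E = \int[leb]_(x in A) (f x)%:E)%E.
Proof.
rewrite [RHS]integral_mkcond; apply: eq_integral => x _.
by rewrite patchE indicE; case: ifP => _; rewrite ?mul1r ?mul0r.
Qed.

Lemma tnth_consT0 k (x : RT) (t : k.-tuple RT) : tnth (consT (x, t)) ord0 = x.
Proof. exact: tnth0. Qed.

Lemma tnth_consTS k (x : RT) (t : k.-tuple RT) i :
  tnth (consT (x, t)) (lift ord0 i) = tnth t i.
Proof. exact: tnthS. Qed.

(** Under the uniform law on the cube the coordinates are independent with mean 0 and variance 1/12.
    The shift [s] stays general in the induction because it absorbs the first coordinate. *)
Lemma integral_cubeI k (th : 'I_k -> R) (s : R) :
  (\int[lam k]_t (cubeI t * (s + \sum_i tnth t i * th i) ^+ 2)%:E =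
   (s ^+ 2 + (\sum_i th i ^+ 2) / 12)%:E)%E.
Proof.
have mF l (th' : 'I_l -> R) c : measurable_fun [set: l.-tuple RT]
    (fun t => (cubeI t * (c + \sum_i tnth t i * th' i) ^+ 2)%:E).
  apply/measurable_EFinP/measurable_funM; first exact: measurable_cubeI.
  apply/measurable_funX/measurable_funD => //; apply: measurable_sum => i.
  by apply: measurable_funM => //; exact: measurable_tnth.
have F0 l (th' : 'I_l -> R) c t :
    (0 <= (cubeI t * (c + \sum_i tnth t i * th' i) ^+ 2)%:E)%E.
  by rewrite lee_fin mulr_ge0 ?cubeI_ge0 ?sqr_ge0.
elim: k th s => [|k IH] th s.
  rewrite integral_dirac//=; last exact: mF.
  rewrite diracT mul1e /cubeI !big_ord0.
  by rewrite mul1r mul0r !addr0.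
rewrite integral_lebesgue_tupleS//.
set S := \sum_i th (lift ord0 i) ^+ 2.
(* [p] is what is left after integrating out all coordinates but the first, and [P] is a primitive
   of it. *)
pose p : {poly R} := (s%:P + th ord0 *: 'X) ^+ 2 + (S / 12)%:P.
pose P : {poly R} := (s ^+ 2 + S / 12) *: 'X + (s * th ord0) *: 'X^2 +
  (th ord0 ^+ 2 / 3) *: 'X^3.
transitivity (\int[leb]_x (\1_I x * p.[x])%:E)%E.
  apply: eq_integral => x _.
  rewrite (_ : p.[x] = (s + x * th ord0) ^+ 2 + S / 12); last first.
    by rewrite /p !hornerE mulrC.
  rewrite EFinM -IH -ge0_integralZl//; last exact: mF.
  apply: eq_integral => t _; rewrite -EFinM /cubeI !big_ord_recl !tnth_consT0.
  rewrite -mulrA addrA; congr (_ * (_ * (_ + _) ^+ 2))%:E.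
    by apply: eq_bigr => i _; rewrite tnth_consTS.
  by apply: eq_bigr => i _; rewrite tnth_consTS.
rewrite (integral_indicM I (horner p)) (integral_itv_horner (P := P)).
- congr EFin; rewrite /P !(hornerD, hornerZ, hornerXn, hornerX) big_ord_recl -/S; by field.
- lra.
rewrite /p /P !poly.derivE /= -!mul_polyC polyCD [(_ ^+ 2 / 3)%:P]polyCM.
have inv3 : (3^-1 : R)%:P * 3 = 1 :> {poly R}.
  transitivity (((3^-1 : R) * 3)%:P); first by rewrite polyCM polyC_natr.
  by rewrite mulVf ?pnatr_eq0.
rewrite polyCM !polyC_exp; move: inv3; move: (3^-1)%:P => v inv3; ring: inv3.
Qed.

End cube.

Section section_volume.
Context {R : realType}.
Local Notation RT := (measurableTypeR R).
Local Notation leb := (@lebesgue_measure R).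
Local Notation lam k := (@lebesgue_tuple R k).
Variables (d : nat) (th : 'rV[R]_(1 + d)) (W : 'M[R]_(d, 1 + d)).
Hypothesis thth : th *m th^T = 1%:M.
Hypothesis Wth : W *m th^T = 0.
Hypothesis WW : W *m W^T = 1%:M.

(* V(c) of the header, for the cube [-1/2, 1/2)^n. *)
Definition cube_section (c : R) : \bar R :=
  (\int[lam d]_y (cubeI (affine W (c *: th) y))%:E)%E.

Let Q : 'M[R]_(1 + d) := col_mx th W.

Let QQ : Q *m Q^T = 1%:M.
Proof.
by rewrite /Q tr_col_mx mul_col_row thth Wth WW (mulmx_tr_eq0 Wth) -scalar_mx_block.
Qed.

Let detQ : `|\det Q| = 1. Proof. exact: normr_det_orthogonal. Qed.

Let affineQ (c : R) (y : d.-tuple RT) :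
  affine Q 0 (consT (c : RT, y)) = affine W (c *: th) y.
Proof.
by rewrite /affine row_of_consT mul_row_col mul_scalar_mx addr0 addrC.
Qed.

Lemma cube_section_ge0 c : (0 <= cube_section c)%E.
Proof. by apply: integral_ge0 => y _; rewrite lee_fin cubeI_ge0. Qed.

(** The orthogonal change of variables [Q] makes <theta, x> the first coordinate, so [cube_section]
    is the density of <theta, x> for x uniform in the cube. *)
Lemma integral_cube_section (g : RT -> R) :
  measurable_fun [set: RT] g -> (forall x, 0 <= g x) ->
  (\int[leb]_c (cube_section c * (g c)%:E) =
   \int[lam (1 + d)]_t (cubeI t * g ((row_of_tuple t *m th^T) ord0 ord0))%:E)%E.
Proof.
move=> mg g0.
pose F (t : (1 + d).-tuple RT) : \bar R :=
  (cubeI t * g ((row_of_tuple t *m th^T) ord0 ord0))%:E.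
have mF : measurable_fun [set: (1 + d).-tuple RT] F.
  apply/measurable_EFinP/measurable_funM; first exact: measurable_cubeI.
  apply: (measurableT_comp mg).
  rewrite (_ : (fun _ => _) = fun t => tnth (affine th^T 0 t) ord0).
    exact: ((measurable_fun_tnthP _).1 (measurable_affine _ _)).
  by apply/funext => t; rewrite tnth_mktuple addr0.
have F0 t : (0 <= F t)%E by rewrite lee_fin mulr_ge0 ?cubeI_ge0.
have mFQ : measurable_fun [set: (1 + d).-tuple RT] (F \o affine Q 0).
  by apply: (measurableT_comp mF); exact: measurable_affine.
have uQ : Q \in unitmx.
  by rewrite unitmxE unitfE -normr_eq0 detQ oner_eq0.
have := rescales_unitmx uQ 0 mF F0; rewrite detQ invr1 mul1e => <-.
rewrite (integral_lebesgue_tupleS mFQ) => [|t]; last exact: F0.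
apply: eq_integral => c _.
rewrite muleC -ge0_integralZl//; last 3 first.
- apply/measurable_EFinP; apply: (measurableT_comp (@measurable_cubeI _ _)).
  exact: measurable_affine.
- by move=> y _; rewrite lee_fin cubeI_ge0.
- by rewrite lee_fin.
apply: eq_integral => y _; rewrite /= /F affineQ -EFinM mulrC; congr (_ * g _)%:E.
rewrite tuple_of_rowK mulmxDl -mulmxA Wth mulmx0 add0r -scalemxAl thth.
by rewrite !mxE mulr1.
Qed.

Lemma measurable_cube_section : measurable_fun [set: RT] cube_section.
Proof.
pose F (t : (1 + d).-tuple RT) : \bar R := (cubeI (affine Q 0 t))%:E.
have mF : measurable_fun [set: (1 + d).-tuple RT] F.
  apply/measurable_EFinP; apply: (measurableT_comp (@measurable_cubeI _ _)).
  exact: measurable_affine.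
have F0 t : (0 <= F t)%E by rewrite lee_fin cubeI_ge0.
rewrite (_ : cube_section = fun c => \int[lam d]_y F (consT (c, y)))%E.
  exact: measurable_integral_lebesgue_tuple.
by apply/funext => c; apply: eq_integral => y _; rewrite -affineQ.
Qed.

Lemma integral_cube_section1 : (\int[leb]_c cube_section c = 1)%E.
Proof.
have := integral_cube_section (g := cst 1).
under eq_integral do rewrite mule1.
move=> ->//; have := integral_cubeI (fun _ : 'I_(1 + d) => 0 : R) 1.
rewrite expr1n big1 ?mul0r ?addr0; last by move=> i _; rewrite expr0n.
move=> <-; apply: eq_integral => t _.
by rewrite big1 ?addr0 ?expr1n// => i _; rewrite mulr0.
Qed.

Lemma integral_cube_section_sqr :
  (\int[leb]_c (cube_section c * (c ^+ 2)%:E) = (12^-1)%:E)%E.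
Proof.
rewrite (integral_cube_section (g := fun c => c ^+ 2))//; last first.
  by move=> x; rewrite sqr_ge0.
have := integral_cubeI (th ord0) 0.
rewrite expr0n add0r (sum_sqr_unit thth) mul1r => <-.
apply: eq_integral => t _; rewrite add0r; congr (_ * _ ^+ 2)%:E.
by rewrite mxE; apply: eq_bigr => i _; rewrite !mxE.
Qed.

(* Among probability densities on the line bounded by M < 1, none has variance
   as small as 1/12, which is that of the uniform density on an interval of
   length 1. *)
Lemma cube_section_gt (M : R) : M < 1 -> exists c, (M%:E < cube_section c)%E.
Proof.
move=> M1; apply: contrapT => nex.
have VM c : (cube_section c <= M%:E)%E.
  by rewrite leNgt; apply/negP => h; apply: nex; exists c.
have M0 : 0 <= M by rewrite -lee_fin (le_trans (cube_section_ge0 0)).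
pose I : set RT := `[- 2^-1, 2^-1[%classic.
have mI : measurable_fun [set: RT] (\1_I : RT -> R).
  by apply: measurable_indic; exact: measurable_itv.
have mV := measurable_cube_section.
have mV2 : measurable_fun [set: RT] (fun c => cube_section c * (c ^+ 2)%:E)%E.
  by apply: emeasurable_funM => //; apply/measurable_EFinP; exact: (@measurable_funX _ RT R setT id 2).
have int1 : (\int[leb]_c (\1_I c * (4^-1 * M))%:E = (4^-1 * M)%:E)%E.
  rewrite (integral_indicM I (fun=> 4^-1 * M)).
  pose p : {poly R} := (4^-1 * M)%:P; pose P : {poly R} := (4^-1 * M) *: 'X.
  transitivity (\int[leb]_(x in I) (p.[x])%:E)%E.
    by apply: eq_integral => x _; rewrite hornerC.
  rewrite /I (@integral_itv_horner R p P).
  - by rewrite !hornerZ !hornerX; congr EFin; field.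
  - lra.
  - by rewrite /P !poly.derivE alg_polyC.
have int2 : (\int[leb]_c (\1_I c * (M * c ^+ 2))%:E = (M / 12)%:E)%E.
  rewrite (integral_indicM I (fun c => M * c ^+ 2)).
  pose p : {poly R} := M *: 'X^2; pose P : {poly R} := (M / 3) *: 'X^3.
  transitivity (\int[leb]_(x in I) (p.[x])%:E)%E.
    by apply: eq_integral => x _; rewrite /p hornerZ hornerXn.
  rewrite /I (@integral_itv_horner R p P).
  - by rewrite !hornerZ !hornerXn; congr EFin; field.
  - lra.
  - by rewrite /P !poly.derivE -[X in _ *: X]scaler_nat scalerA divfK ?pnatr_eq0.
have mfI (g : RT -> R) : measurable_fun [set: RT] g ->
    measurable_fun [set: RT] (fun c => (\1_I c * g c)%:E).
  by move=> mg; apply/measurable_EFinP; exact: measurable_funM.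
have I0 (g : R) c : 0 <= g -> (0 <= (\1_I c * g)%:E)%E.
  by move=> g0; rewrite lee_fin mulr_ge0// indicE.
have msq : measurable_fun [set: RT] (fun c : RT => M * c ^+ 2 : RT).
  by apply: measurable_funM => //; exact: (@measurable_funX _ RT R setT (fun x => x) 2).
have m1 : measurable_fun [set: RT]
    (fun c => 4^-1%:E * cube_section c + (\1_I c * (M * c ^+ 2))%:E)%E.
  by apply: emeasurable_funD; [exact: measurable_funeM|exact: mfI].
have m2 : measurable_fun [set: RT]
    (fun c => cube_section c * (c ^+ 2)%:E + (\1_I c * (4^-1 * M))%:E)%E.
  by apply: emeasurable_funD => //; exact: mfI.
have V40 c : (0 <= 4^-1%:E * cube_section c)%E.
  by apply: mule_ge0; [rewrite lee_fin invr_ge0|exact: cube_section_ge0].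
have Msq0 (c : R) : 0 <= M * c ^+ 2 by rewrite mulr_ge0 ?sqr_ge0.
have Vsq0 c : (0 <= cube_section c * (c ^+ 2)%:E)%E.
  by apply: mule_ge0; [exact: cube_section_ge0|rewrite lee_fin sqr_ge0].
have M40 : 0 <= 4^-1 * M by rewrite mulr_ge0 ?invr_ge0.
have lhs0 (c : R) : (0 <= 4^-1%:E * cube_section c + (\1_I c * (M * c ^+ 2))%:E)%E.
  by apply: adde_ge0 => //; exact: I0.
(* This is (1/4 - c^2)(M - v) >= 0 inside [I] and (c^2 - 1/4) v >= 0 outside. Integrated with v =
   V(c) it gives 1/4 + M/12 <= 1/12 + M/4, hence M >= 1. *)
have key (v c : R) : 0 <= v -> v <= M ->
    4^-1 * v + \1_I c * (M * c ^+ 2) <= v * c ^+ 2 + \1_I c * (4^-1 * M).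
  move=> v0 vM; rewrite indicE mem_setE /= in_itv/=.
  case: (boolP (_ <= c < _)) => [/andP[c1 c2]|].
    have c4 : c ^+ 2 <= 4^-1 by nra.
    have : 0 <= (4^-1 - c ^+ 2) * (M - v) by rewrite mulr_ge0 ?subr_ge0.
    by rewrite !mul1r; lra.
  rewrite negb_and -ltNge -leNgt !mul0r !addr0 => h.
  have c2 : 4^-1 <= c ^+ 2 by case/orP: h => h; nra.
  by rewrite mulrC ler_wpM2l.
have : (\int[leb]_c (4^-1%:E * cube_section c + (\1_I c * (M * c ^+ 2))%:E) <=
   \int[leb]_c (cube_section c * (c ^+ 2)%:E + (\1_I c * (4^-1 * M))%:E))%E.
  apply: ge0_le_integral => //.
  - move=> c _.
    have fV : cube_section c \is a fin_num.
      by rewrite ge0_fin_numE ?cube_section_ge0// (le_lt_trans (VM c)) ?ltry.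
    rewrite -(fineK fV) -EFinM -EFinM -EFinD -EFinD lee_fin; apply: key.
      exact/fine_ge0/cube_section_ge0.
    by rewrite -lee_fin fineK.
rewrite !ge0_integralD//; last 5 first.
- by move=> c _; exact: I0.
- exact: mfI.
- exact: measurable_funeM.
- by move=> c _; exact: I0.
- exact: mfI.
rewrite ge0_integralZl//; last by move=> c _; exact: cube_section_ge0.
rewrite integral_cube_section1 integral_cube_section_sqr int1 int2 mule1.
rewrite lee_fin; lra.
Qed.

End section_volume.

(** * The functional inequality in dimension one *)

Section weighted_determinant.
Context {R : realType}.
Variables (d : nat) (th : 'rV[R]_(1 + d)) (W : 'M[R]_(d, 1 + d)).
Hypothesis thth : th *m th^T = 1%:M.
Hypothesis Wth : W *m th^T = 0.
Hypothesis WW : W *m W^T = 1%:M.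

Lemma orthonormal_resolution : th^T *m th + W^T *m W = 1%:M.
Proof.
have /mulmx1C : col_mx th W *m (col_mx th W)^T = 1%:M.
  by rewrite tr_col_mx mul_col_row thth Wth WW (mulmx_tr_eq0 Wth) -scalar_mx_block.
by rewrite tr_col_mx mul_row_col.
Qed.

(* With Q = col_mx th W and D = diag t, the inverse of Q D Q^T has upper left entry
   th D^-1 th^T; multiplying Q D Q^T by the first row of its inverse leaves
   det (W D W^T). *)
Lemma det_compression (t : 'rV[R]_(1 + d)) : (forall i, 0 < t ord0 i) ->
  \det (W *m diag_mx t *m W^T) =
  (\prod_i t ord0 i) * \sum_i th ord0 i ^+ 2 / t ord0 i.
Proof.
move=> t0; pose D := diag_mx t; pose D' := diag_mx (\row_i (t ord0 i)^-1).
have D'D : D' *m D = 1%:M.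
  rewrite mulmx_diag; apply/matrixP => i j; rewrite !mxE mulVf ?lt0r_neq0//.
pose Q := col_mx th W.
have thW := mulmx_tr_eq0 Wth.
have QQ : Q *m Q^T = 1%:M.
  by rewrite tr_col_mx mul_col_row thth Wth WW thW -scalar_mx_block.
pose B := block_mx (th *m D' *m th^T) (th *m D' *m W^T) 0 1%:M : 'M[R]_(1 + d).
have BE : B *m (Q *m D *m Q^T) =
    block_mx 1%:M 0 (W *m D *m th^T) (W *m D *m W^T).
  have -> : Q *m D *m Q^T = block_mx (th *m D *m th^T) (th *m D *m W^T)
      (W *m D *m th^T) (W *m D *m W^T).
    by rewrite /Q [_ *m D]mul_col_mx tr_col_mx mul_col_row.
  rewrite mulmx_block !mul0mx !mul1mx !add0r.
  have red p (X : 'M[R]_(1 + d, p)) : th *m D' *m th^T *m (th *m D *m X) +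
      th *m D' *m W^T *m (W *m D *m X) = th *m X.
    transitivity (th *m D' *m (th^T *m th + W^T *m W) *m (D *m X)).
      by rewrite mulmxDr mulmxDl !mulmxA.
    by rewrite orthonormal_resolution mulmx1 mulmxA -(mulmxA th) D'D mulmx1.
  by rewrite !red thth thW.
have := congr1 determinant BE.
rewrite det_lblock det1 mul1r => <-; rewrite !det_mulmx det_ublock det1 mulr1.
have detQ : \det Q * \det Q^T = 1 by rewrite -det_mulmx QQ det1.
rewrite [_ * \det D * _]mulrAC detQ mul1r mulrC det_diag det_mx11.
congr (_ * _); rewrite mxE; apply: eq_bigr => i _.
by rewrite mul_mx_diag !mxE expr2 mulrAC.
Qed.

(** After division by the product of the t_i the left side is exp(-L), where L is the w-mean of the
    ln t_i. The bound exp x >= 1 + x is applied at x = L - ln t_i, whose w-mean is 0. *)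
Lemma weighted_AMGM (I : finType) (w t : I -> R) : (forall i, 0 <= w i) ->
  \sum_i w i = 1 -> (forall i, 0 < t i) ->
  expR (\sum_i (1 - w i) * ln (t i)) <= (\prod_i t i) * \sum_i w i / t i.
Proof.
move=> w0 w1 t0; set L := \sum_i w i * ln (t i).
have -> : \prod_i t i = expR (\sum_i ln (t i)).
  by rewrite expR_sum; apply: eq_bigr => i _; rewrite lnK ?posrE.
have -> : \sum_i (1 - w i) * ln (t i) = \sum_i ln (t i) - L.
  by rewrite -sumrB; apply: eq_bigr => i _; rewrite mulrBl mul1r.
rewrite expRD ler_pM2l ?expR_gt0//.
have -> : expR (- L) = \sum_i expR (- L) * (w i * (1 + (L - ln (t i)))).
  rewrite -mulr_sumr; under eq_bigr do rewrite mulrDr mulr1 mulrBr.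
  by rewrite big_split sumrB /= -mulr_suml w1 mul1r -/L subrr addr0 mulr1.
apply: ler_sum => i _.
have -> : w i / t i = expR (- L) * (w i * expR (L - ln (t i))).
  by rewrite mulrCA -expRD addrA addNr add0r expRN lnK// posrE.
by rewrite ler_pM2l ?expR_gt0// ler_wpM2l// expR_ge1Dx.
Qed.

End weighted_determinant.

(** * Transport of the uniform density to step functions *)

Section transport.
Context {R : realType}.
Local Notation RT := (measurableTypeR R).
Local Notation lam k := (@lebesgue_tuple R k).

Lemma in_consecutive (s : nat -> R) N (u : R) : {homo s : i j / (i <= j)%N >-> i <= j} ->
  \sum_(j < N) ((s j <= u < s j.+1)%R%:R : R) = (s 0%N <= u < s N)%R%:R.
Proof.
move=> s_mono.
have E i j : (i <= j)%N -> ((s i <= u < s j)%R%:R : R) = (s i <= u)%R%:R - (s j <= u)%R%:R.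
  move=> /s_mono ij; rewrite ltNge; case: (leP (s i) u) => iu /=.
    by case: (leP (s j) u); rewrite ?subrr ?subr0.
  by rewrite (leNgt (s j)) (lt_le_trans iu ij) subr0.
rewrite E//; under eq_bigr do rewrite E//.
rewrite -(big_mkord xpredT (fun j => (s j <= u)%R%:R - (s j.+1 <= u)%R%:R)).
rewrite -[RHS]opprB -(telescope_sumr (fun j => (s j <= u)%R%:R : R))// -sumrN.
by apply: eq_bigr => j _; rewrite opprB.
Qed.

Variables (d : nat) (th : 'rV[R]_(1 + d)) (W : 'M[R]_(d, 1 + d)).
Hypothesis thth : th *m th^T = 1%:M.
Hypothesis Wth : W *m th^T = 0.
Hypothesis WW : W *m W^T = 1%:M.
Local Notation n := (1 + d)%N.

(** [x - x'] is a multiple of theta and [u - u'] is orthogonal to theta, so their inner product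
    vanishes. Its terms are nonnegative, and positive wherever [u] and [u'] differ. *)
Lemma monotone_coords_inj (u u' x x' : 'rV[R]_n) :
  (u - u') *m th^T = 0 -> x *m W^T = x' *m W^T ->
  (forall i, u ord0 i != u' ord0 i ->
    0 < (x ord0 i - x' ord0 i) * (u ord0 i - u' ord0 i)) -> u = u'.
Proof.
move=> uth xW xu.
have e : (x - x') *m (u - u')^T = 0.
  rewrite -[x - x']mulmx1 -(orthonormal_resolution thth Wth WW) mulmxDr !mulmxA.
  rewrite mulmxDl -!mulmxA.
  by rewrite (mulmx_tr_eq0 uth) !mulmx0 add0r (mulmxA (x - x')) mulmxBl xW subrr mul0mx.
have xu0 i : 0 <= (x ord0 i - x' ord0 i) * (u ord0 i - u' ord0 i).
  by have [->|/xu/ltW//] := eqVneq (u ord0 i) (u' ord0 i); rewrite subrr mulr0.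
apply/rowP => i; apply/eqP; apply: contraT => /xu.
have /psumr_eq0P/(_ i isT) : \sum_i (x ord0 i - x' ord0 i) * (u ord0 i - u' ord0 i) = 0.
  have := congr1 (fun M : 'M[R]_1 => M ord0 ord0) e; rewrite !mxE => h.
  by rewrite -[RHS]h; apply: eq_bigr => j _; rewrite !mxE.
by move=> ->; rewrite ?ltxx.
Qed.

Section data.
Variables (N : nat) (lo eps : R) (a : 'I_n -> nat -> R) (c : R).
Hypothesis eps0 : 0 < eps.
Hypothesis a0 : forall i j, 0 <= a i j.
(** The integral of the step function f_i with value [a i j] on the cell [[lo + j * eps, lo + (j +
    1) * eps[]. *)
Let F i := \sum_(j < N) a i j * eps.
Hypothesis F0 : forall i, 0 < F i.
(* [T i j] maps the j-th interval of a partition of [-1/2, 1/2) into intervals of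
   lengths [p i j] affinely onto the j-th cell, where the density is [a i j]. *)
Let p i j := a i j * eps / F i.
Let s i k := - 2^-1 + \sum_(0 <= j < k) p i j.

Let p0 i j : 0 <= p i j.
Proof. by rewrite /p divr_ge0 ?mulr_ge0 // ltW. Qed.

Let sS i k : s i k.+1 = s i k + p i k.
Proof. by rewrite /s big_nat_recr//= addrA. Qed.

Let s_homo i : {homo s i : j k / (j <= k)%N >-> j <= k}.
Proof.
apply: homo_leq => // [|k]; first exact: le_trans.
by rewrite sS lerDl.
Qed.

Let s_last i : s i N = 2^-1.
Proof.
rewrite /s big_mkord -mulr_suml divff; first lra.
exact: (lt0r_neq0 (F0 i)).
Qed.

(** Where [a i j] is 0 the division returns 0, but then [p i j] is 0 and the j-th interval is
    empty. *)
Let slope i j := F i / a i j.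
Let T i j u := lo + j%:R * eps + (u - s i j) * slope i j.

Let T_cell i j u : s i j <= u < s i j.+1 ->
  0 < a i j /\ lo + j%:R * eps <= T i j u < lo + j.+1%:R * eps.
Proof.
rewrite sS => /andP[u1 u2].
have pij : 0 < p i j by rewrite -(ltrD2l (s i j)) addr0 (le_lt_trans u1).
have aij : 0 < a i j.
  rewrite lt_neqAle a0 andbT eq_sym; apply: contraTneq pij => aij.
  by rewrite /p aij !mul0r ltxx.
have sl : 0 < slope i j by rewrite divr_gt0.
split => //; rewrite /T lerDl mulr_ge0 ?subr_ge0 ?(ltW sl)//=.
rewrite -natr1 [(_ + 1) * eps]mulrDl mul1r addrA ltrD2l.
have -> : eps = p i j * slope i j.
  by rewrite /p /slope mulrC -!mulrA (mulrCA _^-1) ; field; rewrite !gt_eqF.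
by rewrite ltr_pM2r// ltrBlDl.
Qed.

(** On one interval the map is affine with positive slope; different intervals go to cells in the
    same order, and half-open cells keep the inequality strict. *)
Let T_mono i j j' u u' : s i j <= u < s i j.+1 -> s i j' <= u' < s i j'.+1 ->
  u != u' -> 0 < (T i j u - T i j' u') * (u - u').
Proof.
wlog uu' : j j' u u' / u < u'.
  move=> H hu hu' neq; have [lt|gt|eq] := ltgtP u u'.
  - exact: H.
  - by rewrite -mulrNN !opprB; apply: H => //; rewrite eq_sym.
  - by rewrite eq eqxx in neq.
move=> hu hu' _; rewrite -mulrNN !opprB mulr_gt0 ?subr_gt0//.
have [aij /andP[T1 T2]] := T_cell hu.
have [aij' /andP[T1' T2']] := T_cell hu'.
have [jj'|jj'|jj'] := ltngtP j j'.
- apply: (lt_le_trans T2); apply: le_trans T1'.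
  by rewrite lerD2l ler_pM2r// ler_nat.
- case/andP: hu => hu _; case/andP: hu' => _ hu'.
  have := le_lt_trans hu (lt_trans uu' hu').
  by rewrite ltNge (s_homo i jj').
- by rewrite -jj' /T ltrD2l ltr_pM2r ?divr_gt0// ltrD2r.
Qed.

(** One interval for each coordinate: on the box so chosen the map T of all coordinates is
    affine. *)
Let J_t := {ffun 'I_n -> 'I_N}.
Implicit Type J : J_t.

Let box J (t : n.-tuple RT) : R :=
  \prod_i \1_(`[s i (J i), s i (J i).+1[%classic : set R) (tnth t i).

Let measurable_box J : measurable_fun [set: n.-tuple RT] (box J).
Proof. by apply: measurable_prod_indic => i; exact: measurable_itv. Qed.

Let box_neq0P J t : box J t != 0 -> forall i, s i (J i) <= tnth t i < s i (J i).+1.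
Proof.
move=> /prodf_neq0 h i; have := h i isT; rewrite indicE mem_setE /= in_itv/=.
by case: (_ <= _ < _) => //; rewrite eqxx.
Qed.

Let box_ge0 J t : 0 <= box J t.
Proof. by apply: prodr_ge0 => i _; rewrite indicE. Qed.

Let box_le1 J t : box J t <= 1.
Proof. by apply: numdomain.Num.Theory.prodr_ile1 => i _; rewrite indicE ler0n lern1 leq_b1. Qed.

Let sum_box t : \sum_J box J t = cubeI t.
Proof.
rewrite /box -(bigA_distr_bigA (fun i (j : 'I_N) =>
  \1_(`[s i j, s i j.+1[%classic : set R) (tnth t i) : R)).
apply: eq_bigr => i _; under eq_bigr do rewrite indicE mem_setE /= in_itv/=.
rewrite in_consecutive; last exact: s_homo.
by rewrite s_last /s big_nil addr0 indicE mem_setE /= in_itv.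
Qed.

Let TJ J (u : 'rV[R]_n) : 'rV[R]_n := \row_i T i (J i) (u ord0 i).
Let t_ J : 'rV[R]_n := \row_i slope i (J i).
(** On the box [J] the map y |-> W T(W^T y + c theta) is [affine (L J) (beta J)]. *)
Let L J := W *m diag_mx (t_ J) *m W^T.
Let beta J := TJ J (c *: th) *m W^T.

Let TJD J u v : TJ J (u + v) = u *m diag_mx (t_ J) + TJ J v.
Proof. by apply/rowP => i; rewrite mul_mx_diag !mxE /T; ring. Qed.

Let affineL J y : affine (L J) (beta J) y =
  tuple_of_row (TJ J (row_of_tuple (affine W (c *: th) y)) *m W^T).
Proof.
by rewrite /affine tuple_of_rowK TJD mulmxDl /L !mulmxA.
Qed.

Let good J := forall i, 0 < a i (J i).

Let box_good J t : box J t != 0 -> good J.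
Proof. by move=> /box_neq0P bJ i; case: (T_cell (bJ i)). Qed.

Let detL J : good J ->
  expR (\sum_i (1 - th ord0 i ^+ 2) * ln (slope i (J i))) <= \det (L J).
Proof.
move=> gJ; have sl i : 0 < slope i (J i) by rewrite divr_gt0.
rewrite (det_compression thth Wth WW); last by move=> i; rewrite mxE.
have -> : \prod_i t_ J ord0 i = \prod_i slope i (J i).
  by apply: eq_bigr => i _; rewrite mxE.
have -> : \sum_i th ord0 i ^+ 2 / t_ J ord0 i = \sum_i th ord0 i ^+ 2 / slope i (J i).
  by apply: eq_bigr => i _; rewrite mxE.
apply: weighted_AMGM => //; first by move=> i; rewrite sqr_ge0.
exact: (sum_sqr_unit thth).
Qed.

Let unitL J : good J -> L J \in unitmx.
Proof.
move=> /detL h; rewrite unitmxE unitfE gt_eqF// (lt_le_trans _ h)//.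
exact: expR_gt0.
Qed.

Let pre J w := affine (invmx (L J)) (- beta J *m invmx (L J)) w.

Let preK J y : good J -> pre J (affine (L J) (beta J) y) = y.
Proof.
move=> /unitL uL; rewrite /pre /affine tuple_of_rowK mulmxDl mulNmx.
by rewrite mulmxK// addrK row_of_tupleK.
Qed.

Let preVK J w : good J -> affine (L J) (beta J) (pre J w) = w.
Proof.
move=> /unitL uL; rewrite /pre /affine tuple_of_rowK -mulmxDl.
by rewrite mulmxKV// subrK row_of_tupleK.
Qed.

(** The indicator of the image, under the affine piece [J], of the section of the box [J]. If [J] is
    not [good] the box is empty, so this is 0 whatever [invmx] returns. *)
Let image J w := box J (affine W (c *: th) (pre J w)).

(** A point in two images comes from two points of the same section of the cube. These coincide
    because the piecewise affine map is injective, and a point lies in only one box. *)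
Let image_disjoint J J' w : image J w != 0 -> image J' w != 0 -> J = J'.
Proof.
rewrite /image => bJ bJ'.
have := preVK w (box_good bJ); have := preVK w (box_good bJ').
move: (pre J w) (pre J' w) bJ bJ' => y y' bJ bJ'.
rewrite !affineL => <- /(can_inj (@tuple_of_rowK _ _)) e.
set u := affine W (c *: th) y in bJ e; set u' := affine W (c *: th) y' in bJ' e.
have uu' : row_of_tuple u = row_of_tuple u'.
  apply: (monotone_coords_inj _ e) => [|i].
    rewrite /u /u' /affine !tuple_of_rowK opprD addrACA subrr addr0 -mulmxBl.
    by rewrite -mulmxA Wth mulmx0.
  by rewrite !mxE; apply: T_mono; exact: box_neq0P.
apply/ffunP => i.
have := box_neq0P bJ i; have := box_neq0P bJ' i.
rewrite -(can_inj (@row_of_tupleK _ _) uu') => /andP[h1 h2] /andP[h3 h4].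
apply: val_inj; apply/eqP; rewrite eqn_leq; apply/andP; split; rewrite leqNgt.
- by apply/negP => /(s_homo i); rewrite leNgt (le_lt_trans h3 h2).
- by apply/negP => /(s_homo i); rewrite leNgt (le_lt_trans h1 h4).
Qed.

Let image_le1 J w : image J w <= 1. Proof. exact: box_le1. Qed.
Let image_ge0 J w : 0 <= image J w. Proof. exact: box_ge0. Qed.

Let measurable_image J : measurable_fun [set: d.-tuple RT] (image J).
Proof.
apply: (measurableT_comp (@measurable_box J)).
apply: (measurableT_comp (measurable_affine _ _)); exact: measurable_affine.
Qed.

(** For a [good] [J], this is the value of prod f_i^c_i on the product of the chosen cells; [bound]
    is prod (int f_i)^c_i. *)
Let kap J := expR (\sum_i (1 - th ord0 i ^+ 2) * ln (a i (J i))).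
Let bound := expR (\sum_i (1 - th ord0 i ^+ 2) * ln (F i)).

(** The affine piece multiplies volume by det([L J]), which is at least the product of the (F_i /
    a_i)^c_i, that is [bound] divided by [kap J]. *)
Let integral_image J :
  (bound%:E * \int[lam d]_y (box J (affine W (c *: th) y))%:E <=
   (kap J)%:E * \int[lam d]_w (image J w)%:E)%E.
Proof.
have ge0 b f : 0 <= b -> (forall t, 0 <= f t) ->
    (0 <= b%:E * \int[lam d]_w (f w)%:E)%E.
  by move=> *; apply: mule_ge0 => //; apply: integral_ge0 => t _; rewrite lee_fin.
have [gJ|nJ] := pselect (good J); last first.
  rewrite integral0_eq ?mule0 ?ge0 ?expR_ge0// => y _; apply/eqP.
  by rewrite eqe; apply: contra_notT nJ; exact: box_good.
have f0 t : (0 <= (image J t)%:E)%E by rewrite lee_fin.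
have mf : measurable_fun [set: d.-tuple RT] (fun t => (image J t)%:E).
  exact/measurable_EFinP.
have dL : 0 < \det (L J) by exact: lt_le_trans (expR_gt0 _) (detL gJ).
have := rescales_unitmx (unitL gJ) (beta J) mf f0.
rewrite (_ : (\int[lam d]_y _)%E =
    \int[lam d]_y (box J (affine W (c *: th) y))%:E)%E; last first.
  by apply: eq_integral => y _; rewrite /image preK.
move=> ->; rewrite gtr0_norm// muleA -EFinM; apply: lee_wpmul2r.
  by apply: integral_ge0 => t _; exact: f0.
rewrite lee_fin ler_pdivrMr// (le_trans _ (ler_wpM2l (expR_ge0 _) (detL gJ)))//.
rewrite /kap -expRD -big_split /bound /= ler_expR; apply: ler_sum => i _.
rewrite -mulrDr -lnM ?posrE ?divr_gt0// mulrC /slope.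
by rewrite (mulrCA _ (F i)) divff ?gt_eqF// mulr1 mulrC.
Qed.

(** On the image of the box [J] the function [h] is at least [kap J]. The images are disjoint, so
    [h] dominates the sum of all [kap J * image J], while the sections of the boxes add up to the
    section of the cube. *)
Lemma transport_integral_ge (h : d.-tuple RT -> \bar R) :
  measurable_fun [set: d.-tuple RT] h -> (forall w, 0 <= h w)%E ->
  (forall (J : {ffun 'I_n -> 'I_N}) (x : 'rV[R]_n), (forall i, 0 < a i (J i)) ->
    (forall i, lo + (J i)%:R * eps <= x ord0 i < lo + (J i).+1%:R * eps) ->
    ((expR (\sum_i (1 - th ord0 i ^+ 2) * ln (a i (J i))))%:E <=
     h (tuple_of_row (x *m W^T)))%E) ->
  ((expR (\sum_i (1 - th ord0 i ^+ 2) * ln (\sum_(j < N) a i j * eps)))%:E *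
     cube_section th W c <= \int[lam d]_w h w)%E.
Proof.
move=> mh h0 hJ.
have mbox J : measurable_fun [set: d.-tuple RT]
    (fun y => (box J (affine W (c *: th) y))%:E).
  apply/measurable_EFinP; apply: (measurableT_comp (@measurable_box J)).
  exact: measurable_affine.
have mim J : measurable_fun [set: d.-tuple RT]
    (fun w => (kap J)%:E * (image J w)%:E)%E.
  by apply: measurable_funeM; exact/measurable_EFinP.
have im0 J w : (0 <= (kap J)%:E * (image J w)%:E)%E.
  by rewrite -EFinM lee_fin mulr_ge0 ?expR_ge0.
apply: (@le_trans _ _ (\int[lam d]_w \sum_(J : J_t) (kap J)%:E * (image J w)%:E)%E).
  rewrite ge0_integral_sum//.
  rewrite (_ : cube_section th W c =
    \sum_(J : J_t) \int[lam d]_y (box J (affine W (c *: th) y))%:E)%E; last first.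
    rewrite -ge0_integral_sum//; last by move=> J y _; rewrite lee_fin.
    by apply: eq_integral => y _; rewrite -sum_box sumEFin.
  rewrite ge0_sume_distrr; last first.
    by move=> J _; apply: integral_ge0 => y _; rewrite lee_fin.
  apply: lee_sum => J _; rewrite ge0_integralZl//.
  - exact/measurable_EFinP.
  - by move=> w _; rewrite lee_fin.
  - by rewrite lee_fin expR_ge0.
apply: ge0_le_integral => //.
- by move=> w _; apply: sume_ge0 => J _; exact: im0.
- exact: emeasurable_sum.
move=> w _.
have [[J imJ]|noJ] := pselect (exists J, image J w != 0); last first.
  rewrite big1// => J _; apply/eqP; rewrite -EFinM eqe mulf_eq0.
  by apply/orP; right; apply: contra_notT noJ => ?; exists J.
rewrite (bigD1 J)//= big1 ?adde0; last first.
  move=> J' J'J; apply/eqP; rewrite -EFinM eqe mulf_eq0; apply/orP; right.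
  by apply: contraNT J'J => imJ'; rewrite (image_disjoint imJ' imJ).
have gJ := box_good imJ.
apply: (@le_trans _ _ (kap J)%:E).
  by rewrite -EFinM lee_fin ler_piMr ?expR_ge0.
rewrite -[w in h w](preVK w gJ) affineL; apply: hJ => // i.
rewrite mxE; have := box_neq0P imJ i; rewrite mxE => /T_cell[_].
by [].
Qed.

End data.
End transport.

(** * Unions of grid cubes *)

Lemma card_cons_tuple (T : finType) m (A : {set m.+1.-tuple T}) :
  #|A| = (\sum_(x : T) #|[set t : m.-tuple T | cons_tuple x t \in A]%SET|)%N.
Proof.
rewrite -sum1_card big_mkcond /=.
rewrite (reindex (fun p : T * m.-tuple T => cons_tuple p.1 p.2)) /=; last first.
  exists (fun t => (thead t, behead_tuple t)) => [[x t]|t] _.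
    by congr pair; exact: val_inj.
  by rewrite [RHS]tuple_eta; exact: val_inj.
rewrite -(pair_bigA _ (fun x t => if cons_tuple x t \in A then 1 else 0)%N) /=.
by apply: eq_bigr => x _; rewrite -big_mkcond sum1dep_card.
Qed.

Section grid.
Context {R : realType}.
Local Notation RT := (measurableTypeR R).
Local Notation lam k := (@lebesgue_tuple R k).
Variables (d : nat) (th : 'rV[R]_(1 + d)) (W : 'M[R]_(d, 1 + d)).
Hypothesis thth : th *m th^T = 1%:M.
Hypothesis Wth : W *m th^T = 0.
Hypothesis WW : W *m W^T = 1%:M.
Local Notation n := (1 + d)%N.

(* The matrix W X for X : 'M_(1 + d, m), read column by column: coordinate k of
   R^m gives the k-th block of d entries.  Columns of X are indexed by all of nat
   so that the recursion on m just shifts the index. *)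
Fixpoint compress m (X : 'I_n -> nat -> R) : (m * d).-tuple RT :=
  match m with
  | 0 => [tuple]
  | m'.+1 => cat_tuple (tuple_of_row ((\row_i X i 0%N) *m W^T))
               (compress m' (fun i k => X i k.+1))
  end.

Variables (N : nat) (lo eps c v : R).
Hypothesis eps0 : 0 < eps.
Hypothesis v0 : 0 < v.
Hypothesis vc : (v%:E <= cube_section th W c)%E.

Definition in_cell m (t : m.-tuple 'I_N) (x : nat -> R) :=
  forall k : 'I_m, lo + (tnth t k)%:R * eps <= x k < lo + (tnth t k).+1%:R * eps.

(** Induction on m, one column at a time. The step function for factor i has as its j-th value the
    volume [a i j] of the slice of the i-th union of cubes over cell j of the first coordinate. By
    induction the integral of [h] over the later columns is at least [v ^+ m] times the product of
    the slice volumes to the powers c_i; the first column contributes one more factor V(c) >= v. *)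
Lemma grid_integral_ge m (A : 'I_n -> {set m.-tuple 'I_N})
    (h : (m * d).-tuple RT -> \bar R) :
  (forall i, A i != finset.set0) ->
  measurable_fun [set: (m * d).-tuple RT] h -> (forall t, 0 <= h t)%E ->
  (forall X, (forall i, exists2 t, t \in A i & in_cell t (X i)) ->
    (1 <= h (compress m X))%E) ->
  ((v ^+ m * expR (\sum_i (1 - th ord0 i ^+ 2) * ln (#|A i|%:R * eps ^+ m)))%:E
     <= \int[lam (m * d)]_t h t)%E.
Proof.
elim: m A h => [|m IH] A h An mh h0 hA.
  rewrite integral_dirac//= diracT mul1e.
  have A1 i : #|A i| = 1%N.
    apply/eqP; rewrite eqn_leq card_gt0 An andbT (leq_trans (max_card _))//.
    by rewrite card_tuple expn0.
  rewrite big1; last by move=> i _; rewrite A1 mulr1 ln1 mulr0.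
  rewrite expR0 mulr1 expr0; apply: (hA (fun _ _ => 0)) => i.
  by have /set0Pn[t At] := An i; exists t => // -[].
(* The one-dimensional inequality indexes cells by [nat]; slices out of range are taken empty. *)
pose Aj i (j : nat) : {set m.-tuple 'I_N} :=
  if insub j is Some j' then [set t : m.-tuple 'I_N | cons_tuple j' t \in A i]%SET
  else finset.set0.
pose a i j := #|Aj i j|%:R * eps ^+ m.
pose g s := (\int[lam (m * d)]_t h (cat_tuple s t))%E.
have mg : measurable_fun [set: d.-tuple RT] g by exact: measurable_integral_cat_tuple.
have g0 s : (0 <= g s)%E by apply: integral_ge0 => t _; exact: h0.
have vm0 : 0 < v ^+ m by rewrite exprn_gt0.
have a0 i j : 0 <= a i j by rewrite mulr_ge0// exprn_ge0// ltW.
have sum_a i : \sum_(j < N) a i j * eps = #|A i|%:R * eps ^+ m.+1.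
  rewrite (card_cons_tuple (A i)) natr_sum mulr_suml; apply: eq_bigr => j _.
  by rewrite /a /Aj valK -mulrA -exprSr.
have F0 i : 0 < \sum_(j < N) a i j * eps.
  by rewrite sum_a mulr_gt0 ?exprn_gt0// ltr0n card_gt0.
have mgz : measurable_fun [set: d.-tuple RT] (fun s => (v ^- m)%:E * g s)%E.
  exact: measurable_funeM.
have gz0 s : (0 <= (v ^- m)%:E * g s)%E by rewrite mule_ge0// lee_fin invr_ge0 ltW.
have hJ (J : {ffun 'I_n -> 'I_N}) (x : 'rV[R]_n) : (forall i, 0 < a i (J i)) ->
    (forall i, lo + (J i)%:R * eps <= x ord0 i < lo + (J i).+1%:R * eps) ->
    ((expR (\sum_i (1 - th ord0 i ^+ 2) * ln (a i (J i))))%:E <=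
     (v ^- m)%:E * g (tuple_of_row (x *m W^T)))%E.
  move=> aJ xJ; rewrite lee_pdivlMl// -EFinM /g.
  apply: (IH (fun i => Aj i (J i))) => [i||t|X AX].
  - by have := aJ i; rewrite /a pmulr_lgt0 ?exprn_gt0// ltr0n card_gt0.
  - by apply: (measurableT_comp mh); exact: measurable_cat_tuple.
  - exact: h0.
  pose X' i k := if k is k'.+1 then X i k' else x ord0 i.
  rewrite (_ : cat_tuple _ _ = compress m.+1 X'); last first.
    rewrite /= (_ : \row_i X' i 0%N = x)//.
    by apply/rowP => i; rewrite mxE.
  apply: hA => i; have [t At tX] := AX i.
  exists (cons_tuple (J i) t); first by move: At; rewrite /Aj valK inE.
  move=> k; have [k' ->|->] := unliftP ord0 k; last by rewrite tnth0; exact: xJ.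
  by rewrite tnthS; exact: tX.
have := @transport_integral_ge R d th W thth Wth WW N lo eps a c eps0 a0 F0
  (fun s => (v ^- m)%:E * g s)%E mgz gz0 hJ.
rewrite ge0_integralZl//; last by rewrite lee_fin invr_ge0 ltW.
rewrite -[X in (_ <= _ * X)%E](integral_cat_tuple mh h0).
under eq_bigr do rewrite sum_a.
rewrite lee_pdivlMl//; apply: le_trans.
rewrite exprSr -mulrA EFinM; apply: lee_wpmul2l; first by rewrite lee_fin ltW.
rewrite mulrC EFinM; apply: lee_wpmul2l => //.
Qed.

End grid.

(** * Equal sets, with section volumes tending to one *)

Section grid_limit.
Context {R : realType}.
Local Notation RT := (measurableTypeR R).
Local Notation lam k := (@lebesgue_tuple R k).

Lemma bernoulli_ineq (x : R) m : 0 <= x <= 1 -> 1 - m%:R * x <= (1 - x) ^+ m.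
Proof.
move=> /andP[x0 x1]; elim: m => [|m IH]; first by rewrite mul0r subr0 expr0.
rewrite exprS; apply: le_trans (ler_wpM2l _ IH); last by rewrite subr_ge0.
have : 0 <= m%:R * x * x by rewrite !mulr_ge0.
by rewrite -natr1 -subr_ge0 => h; rewrite -subr_ge0; apply: le_trans h _; lra.
Qed.

Lemma le_of_expr_lt1 (k : R) (b : \bar R) m : 0 < k ->
  (forall M, 0 < M < 1 -> ((M ^+ m * k)%:E <= b)%E) -> (k%:E <= b)%E.
Proof.
move=> k0 H; case: b H => [b| |] H; last 2 first.
- by rewrite leey.
- by have := H 2^-1; rewrite invr_gt0 ltr0n invf_lt1// ltr1n => /(_ isT); rewrite leeNy_eq.
rewrite lee_fin leNgt; apply/negP => bk.
have b0 : 0 < b.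
  rewrite -lte_fin; apply: lt_le_trans (H 2^-1 _).
    by rewrite lte_fin mulr_gt0 ?exprn_gt0 ?invr_gt0.
  by rewrite invr_gt0 ltr0n invf_lt1// ltr1n.
(* With this y, (1 - y) k is the midpoint of b and k, hence above b. The choice of x gives m x <= y,
   and [m.+1] avoids dividing by 0. *)
pose y := (k - b) / (k + k); pose x := y / m.+1%:R.
have y0 : 0 < y by rewrite divr_gt0 ?subr_gt0 ?addr_gt0//.
have y1 : y < 1 by rewrite ltr_pdivrMr ?addr_gt0//; lra.
have x0 : 0 < x by rewrite divr_gt0.
have xy : x <= y by rewrite ler_pdivrMr// ler_peMr ?ler1n// ltW.
have mxy : m%:R * x <= y.
  by rewrite mulrCA ler_piMr ?ltW// ltr_pdivrMr// mul1r ltr_nat.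
have := H (1 - x); rewrite lee_fin => /(_ _); rewrite subr_gt0 (le_lt_trans xy y1)/=.
rewrite ltrBlDr ltrDl x0 => /(_ isT); apply/negP; rewrite -ltNge.
have x01 : 0 <= x <= 1 by rewrite (ltW x0) (le_trans xy (ltW y1)).
apply: lt_le_trans (ler_wpM2r (ltW k0) (bernoulli_ineq m x01)).
apply: (@lt_le_trans _ _ ((1 - y) * k)); last first.
  by apply: ler_wpM2r; [exact: ltW|rewrite lerD2l lerN2].
have : y * (k + k) = k - b by rewrite /y divfK// gt_eqF// addr_gt0.
by lra.
Qed.

Variables (d : nat) (th : 'rV[R]_(1 + d)) (W : 'M[R]_(d, 1 + d)).
Hypothesis thth : th *m th^T = 1%:M.
Hypothesis Wth : W *m th^T = 0.
Hypothesis WW : W *m W^T = 1%:M.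
Local Notation n := (1 + d)%N.

Lemma sum_weights : \sum_(i < n) (1 - th ord0 i ^+ 2) = d%:R.
Proof.
rewrite sumrB sumr_const card_ord (sum_sqr_unit thth) natrD.
by rewrite addrAC subrr add0r.
Qed.

(** For n equal sets the exponents c_i add up to d, so the product is the d-th power of one volume.
    Sections with V(c) > M exist for every M < 1, and the factor [M ^+ m] disappears in the
    limit. *)
Lemma grid_projection_ge N (lo eps : R) m (A : {set m.-tuple 'I_N})
    (h : (m * d).-tuple RT -> \bar R) : 0 < eps ->
  A != finset.set0 ->
  measurable_fun [set: (m * d).-tuple RT] h -> (forall t, 0 <= h t)%E ->
  (forall X : 'I_n -> nat -> R, (forall i, exists2 t, t \in A & in_cell lo eps t (X i)) ->
    (1 <= h (compress W m X))%E) ->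
  (((#|A|%:R * eps ^+ m) ^+ d)%:E <= \int[lam (m * d)]_t h t)%E.
Proof.
move=> eps0 A0 mh h0 hA.
have vol0 : 0 < #|A|%:R * eps ^+ m :> R.
  by rewrite mulr_gt0 ?exprn_gt0// ltr0n card_gt0.
apply: (@le_of_expr_lt1 _ _ m); first by rewrite exprn_gt0.
move=> M /andP[M0 M1].
have [c /ltW Mc] := cube_section_gt thth Wth WW M1.
have := grid_integral_ge thth Wth WW eps0 M0 Mc (fun=> A0) mh h0 hA.
rewrite -mulr_suml sum_weights mulr_natl -lnXn//.
by rewrite lnK ?posrE ?exprn_gt0// mulrC.
Qed.

End grid_limit.

(** * Compact sets *)

Section row_topology.
Context {R : realType}.
Local Notation RT := (measurableTypeR R).

Lemma measurable_tuple_box k (A : 'I_k -> set RT) :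
  (forall i, measurable (A i)) ->
  measurable [set t : k.-tuple RT | forall i, A i (tnth t i)].
Proof.
move=> mA; rewrite (_ : [set t | _] =
    \bigcap_(i in [set: 'I_k]) ((fun t : k.-tuple RT => tnth t i) @^-1` A i)).
  apply: fin_bigcap_measurable => // i _.
  by rewrite -[X in measurable X]setTI; exact: measurable_tnth.
by apply/seteqP; split => [x h i _|x h i]; [exact: h|exact: (h i I)].
Qed.

(** An open set is the union of the countably many balls with rational centre and radius 1/(N + 1)
    inside it; in the sup norm balls are boxes. *)
Lemma open_measurable_tuple k (U : set 'rV[R]_k) : open U ->
  measurable [set t : k.-tuple RT | U (row_of_tuple t)].
Proof.
move=> oU.
pose B (q : 'rV[rat]_k * nat) : set 'rV[R]_k := ball (map_mx ratr q.1 : 'rV[R]_k) q.2.+1%:R^-1.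
pose F q := [set t : k.-tuple RT | B q `<=` U /\ B q (row_of_tuple t)].
have -> : [set t : k.-tuple RT | U (row_of_tuple t)] = \bigcup_q F q.
  apply/seteqP; split => [t /= Ut|t [q _ [BU /BU]]//].
  have /nbhs_ballP[e /= e0 eU] : nbhs (row_of_tuple t) U by exact: open_nbhs_nbhs.
  have [N N0] : exists N, N.+1%:R^-1 < e / 2.
    have /ltr_add_invr[N] : 0 < e / 2 by rewrite divr_gt0.
    by rewrite add0r; exists N.
  have qP i : exists q : rat, `|ratr q - tnth t i| < N.+1%:R^-1.
    have /rat_in_itvoo[q] : tnth t i - N.+1%:R^-1 < tnth t i + N.+1%:R^-1.
      by rewrite ltrD2l gtrN// invr_gt0.
    rewrite in_itv/= => qt; exists q; rewrite ltr_distl.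
    by move: qt; rewrite ltrBlDr.
  have [q tq] := choice qP.
  have Bt : B (\row_i q i, N) (row_of_tuple t).
    split; first by rewrite invr_gt0.
    by move=> i j; rewrite !mxE /ball /=; exact: tq.
  exists (\row_i q i, N) => //; split => //.
  apply: subset_trans eU => x; rewrite /B /= => Bx.
  apply: (@le_ball _ _ _ (N.+1%:R^-1 + N.+1%:R^-1)); first by rewrite [leRHS]splitr lerD// ltW.
  by apply: ball_triangle Bx; apply: ball_sym.
apply: countable_bigcupT_measurable => // q.
have [BU|BU] := pselect (B q `<=` U); last first.
  rewrite (_ : F q = set0); first exact: measurable0.
  by apply/seteqP; split => // t [].
rewrite (_ : F q = [set t : k.-tuple RT | forall i,
    (ball (ratr (q.1 ord0 i) : R) q.2.+1%:R^-1 : set RT) (tnth t i)]).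
  apply: (@measurable_tuple_box _ (fun i => ball (ratr (q.1 ord0 i) : R) _)) => i.
  exact: measurable_ball.
apply/seteqP; split => [t [_ [_ Bt]] i|t Bt].
  by have := Bt ord0 i; rewrite !mxE.
split => //; split; first by rewrite invr_gt0.
by move=> j i; rewrite (ord1 j) !mxE; exact: Bt.
Qed.

Lemma continuous_mx (T : topologicalType) k l (f : T -> 'M[R]_(k, l)) :
  (forall i j, continuous (fun x => f x i j)) -> continuous f.
Proof.
move=> fij x A [P fP PA]; rewrite nbhs_simpl/=.
have : \forall y \near x, forall i j, P i j (f y i j).
  apply: filter_forall => i; apply: filter_forall => j.
  exact: (fij i j x _ (fP i j)).
by apply: filterS => y Py; apply: PA.
Qed.

End row_topology.

Section compact_projection.
Context {R : realType}.
Local Notation RT := (measurableTypeR R).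
Local Notation lam k := (@lebesgue_tuple R k).

Lemma coordinate_continuous (T : topologicalType) k l i j :
  continuous (fun M : 'M[T]_(k, l) => M i j).
Proof.
move=> M A MA.
exists (fun i' j' => if (i' == i) && (j' == j) then A else setT).
  by move=> i' j'; case: ifP => [/andP[/eqP -> /eqP ->]//|_]; exact: filterT.
by move=> N /(_ i j); rewrite !eqxx.
Qed.

Variables (d : nat) (W : 'M[R]_(d, 1 + d)).
Local Notation n := (1 + d)%N.

Lemma tnth_compress m (X : 'I_n -> nat -> R) (q : 'I_(m * d)) (k : nat) (j : 'I_d) :
  (q = k * d + j :> nat)%N ->
  tnth (compress W m X) q = \sum_i X i k * W j i.
Proof.
elim: m X q k => [|m IH] X q k; first by case: q.
rewrite /=; case: (@split_ordP d (m * d) q) => q' -> /= qk.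
  have k0 : k = 0%N.
    case: k qk => // k; have := ltn_ord q'; rewrite mulSn => + q'E.
    by rewrite q'E -addnA ltnNge leq_addr.
  rewrite tnth_lshift tnth_mktuple !mxE k0.
  have -> : q' = j by apply: val_inj; rewrite /= qk k0.
  by apply: eq_bigr => i _; rewrite !mxE.
case: k qk => [|k] qk.
  by have := ltn_ord j; rewrite -[X in (X < _)%N]add0n -[(0 + j)%N]qk ltnNge leq_addr.
rewrite tnth_rshift (IH _ _ k)//.
by move: qk; rewrite mulSn -addnA => /addnI.
Qed.

Lemma ord_mul_eq m (q : 'I_(m * d)) :
  exists (k : 'I_m) (j : 'I_d), (q = k * d + j :> nat)%N.
Proof.
have d0 : (0 < d)%N by case: d q => // -[]; rewrite muln0.
have km : (q %/ d < m)%N by rewrite ltn_divLR.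
exists (Ordinal km), (Ordinal (ltn_pmod q d0)) => /=.
exact: divn_eq.
Qed.

(* The value 0 for k >= m is never used. *)
Definition rV_entry m (v : 'rV[R]_m) (k : nat) : R :=
  if insub k is Some k' then v ord0 k' else 0.

Lemma rV_entryE m (v : 'rV[R]_m) (k : 'I_m) : rV_entry v k = v ord0 k.
Proof. by rewrite /rV_entry valK. Qed.

(** The projection of K^n onto the span of the rows of [W], in the coordinates these rows give. *)
Definition compressed m (K : set 'rV[R]_m) : set 'rV[R]_(m * d) :=
  [set w | exists2 X : 'I_n -> 'rV[R]_m, forall i, K (X i) &
     w = row_of_tuple (compress W m (fun i => rV_entry (X i)))].

(** A continuous image of K^n, which is encoded as a row of rows so that compactness of products of
    sets applies. *)
Lemma compact_compressed m (K : set 'rV[R]_m) :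
  compact K -> compact (compressed K).
Proof.
move=> cK.
pose f (v : 'rV['rV[R]_m]_n) : 'rV[R]_(m * d) :=
  row_of_tuple (compress W m (fun i => rV_entry (v ord0 i))).
rewrite (_ : compressed K = f @` [set v : 'rV['rV[R]_m]_n | forall i, K (v ord0 i)]).
  apply: continuous_compact; last exact: (@rV_compact _ n (fun=> K)).
  apply: continuous_subspaceT; apply: continuous_mx => i q.
  have [k [j qE]] := ord_mul_eq q.
  rewrite (_ : (fun _ => _) = fun v : 'rV['rV[R]_m]_n =>
      \sum_l (v ord0 l) ord0 k * W j l); last first.
    apply/funext => v; rewrite mxE (tnth_compress _ qE).
    by apply: eq_bigr => l _; rewrite rV_entryE.
  apply: continuous_big => [|l _]; first exact: add_continuous.
  move=> v; have FF : Filter (nbhs v) := nbhs_filter v.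
  apply: cvgM => //; last exact: (@cvg_cst _ _ _ (nbhs v)).
  exact: (continuous_comp (@coordinate_continuous _ _ _ ord0 l _)
    (@coordinate_continuous _ _ _ ord0 k _)).
apply/seteqP; split => [w [X KX ->]|w [v Kv <-]].
  exists (\row_i X i); first by move=> i; rewrite mxE.
  by rewrite /f; congr (row_of_tuple (compress _ _ _)); apply/funext => i; rewrite mxE.
by exists (fun i => v ord0 i).
Qed.

End compact_projection.

Section outer_approximation.
Context {R : realType}.
Local Notation RT := (measurableTypeR R).
Local Notation lam k := (@lebesgue_tuple R k).

Lemma closed_measurable_tuple k (A : set 'rV[R]_k) : closed A ->
  measurable [set t : k.-tuple RT | A (row_of_tuple t)].
Proof.
move=> cA; rewrite -[X in measurable X]setCK; apply: measurableC.
by apply: (@open_measurable_tuple _ _ (~` A)); exact: closed_openC.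
Qed.

Lemma compact_rV_bounded k (A : set 'rV[R]_k) : compact A ->
  exists2 b : R, 0 < b & forall x, A x -> forall i, `|x ord0 i| <= b.
Proof.
move=> /compact_bounded[b [_ hb]].
exists (`|b| + 1); first by rewrite ltr_wpDl.
move=> x Ax i; apply: le_trans (hb (`|b| + 1) _ x Ax).
  by rewrite [leRHS]/Num.norm /= mx_normrE; apply/bigmax_geP; right => /=; exists (ord0, i).
by rewrite (le_lt_trans (ler_norm b))// ltrDl.
Qed.

Lemma lebesgue_grid_cell N (lo eps : R) m (t : m.-tuple 'I_N) : 0 < eps ->
  measurable [set x : m.-tuple RT | in_cell lo eps t (rV_entry (row_of_tuple x))] /\
  lam m [set x | in_cell lo eps t (rV_entry (row_of_tuple x))] = (eps ^+ m)%:E.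
Proof.
move=> eps0.
pose cell k : set RT := `[lo + (tnth t k)%:R * eps, lo + (tnth t k).+1%:R * eps[%classic.
have -> : [set x : m.-tuple RT | in_cell lo eps t (rV_entry (row_of_tuple x))] =
    [set x | forall i, cell i (tnth x i)].
  apply/seteqP; split => x /= h k; have := h k; rewrite rV_entryE mxE /cell /= in_itv/=.
    by [].
  by [].
have mI k : measurable (cell k) by exact: measurable_itv.
split; first exact: measurable_tuple_box.
rewrite lebesgue_tuple_box//.
under eq_bigr => k _.
  rewrite /cell lebesgue_measure_itv/= lte_fin ltrD2l ltr_pM2r// ltr_nat ltnSn.
  rewrite -EFinB (_ : _ - _ = eps); last by rewrite -natr1; ring.
  over.
by rewrite prodEFin prodr_const card_ord.
Qed.

End outer_approximation.

(** * From grid cubes to compact sets *)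

Section compressed_volume.
Context {R : realType}.
Local Notation RT := (measurableTypeR R).
Local Notation lam k := (@lebesgue_tuple R k).
Variables (d : nat) (th : 'rV[R]_(1 + d)) (W : 'M[R]_(d, 1 + d)).
Hypothesis thth : th *m th^T = 1%:M.
Hypothesis Wth : W *m th^T = 0.
Hypothesis WW : W *m W^T = 1%:M.
Local Notation n := (1 + d)%N.

Definition thickening k (A : set 'rV[R]_k) (e : R) : set (k.-tuple RT) :=
  [set t | exists2 w, A w & ball w e (row_of_tuple t)].

Lemma measurable_thickening k (A : set 'rV[R]_k) e : measurable (thickening A e).
Proof.
rewrite (_ : thickening A e = [set t | (\bigcup_(w in A) (ball w e)) (row_of_tuple t)])//.
have [e0|e0] := ltP 0 e.
  by apply: open_measurable_tuple; apply: bigcup_open => w _; exact: ball_open.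
rewrite (_ : [set t | _] = set0); first exact: measurable0.
by apply/seteqP; split => // t [w _ [+ _]]; rewrite ltNge e0.
Qed.

(** The grid cubes that meet K cover K. Each point of such a cube is within [eps] of K in every
    coordinate, so projecting the n-fold power of their union stays in the [e]-neighbourhood of the
    projection of K^n. *)
Lemma lebesgue_thickening_ge m (K : set 'rV[R]_m) (e : R) :
  compact K -> K !=set0 -> 0 < e ->
  (lam m [set t | K (row_of_tuple t)] ^+ d <=
   lam (m * d) (thickening (compressed W K) e))%E.
Proof.
move=> cK [x0 Kx0] e0; have [b b0 Kb] := compact_rV_bounded cK.
(* S exceeds the sum of absolute values in each row of [W]; the added 1 keeps it positive when d =
   0. *)
pose S := \sum_j \sum_i `|W j i| + 1.
have S0 : 0 < S.
  by rewrite ltr_wpDl// sumr_ge0// => j _; rewrite sumr_ge0.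
pose eps := e / S.
have eps0 : 0 < eps by rewrite divr_gt0.
have Weps (j : 'I_d) : eps * \sum_i `|W j i| < e.
  rewrite /eps mulrAC ltr_pdivrMr// ltr_pM2l// /S ltr_pwDr// (bigD1 j)//=.
  by rewrite lerDl sumr_ge0// => k _; rewrite sumr_ge0.
(* Enough cells of length [eps], starting at -b, to cover [-b, b] including its right end. *)
pose N := (Num.truncn ((b + b) / eps)).+1.
pose A := [set t : m.-tuple 'I_N |
  `[< exists2 x, K x & in_cell (- b) eps t (rV_entry x) >]]%SET.
have cover x : K x -> exists2 t, t \in A & in_cell (- b) eps t (rV_entry x).
  move=> Kx.
  pose j k : nat := Num.truncn ((x ord0 k + b) / eps).
  have xb k : 0 <= x ord0 k + b <= b + b.
    by have := Kb x Kx k; rewrite ler_norml lerD2r => /andP[+ ->]; rewrite -subr_ge0 opprK => ->.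
  have xj0 k : 0 <= (x ord0 k + b) / eps.
    by have /andP[? _] := xb k; rewrite divr_ge0// ltW.
  have jN k : (j k < N)%N.
    rewrite ltnS; apply: le_truncn; have /andP[_ ?] := xb k.
    by rewrite ler_pM2r// invr_gt0.
  pose t : m.-tuple 'I_N := [tuple Ordinal (jN k) | k < m].
  have tx : in_cell (- b) eps t (rV_entry x).
    move=> k; rewrite tnth_mktuple rV_entryE /=.
    have /andP[h1 h2] := truncn_itv (xj0 k).
    rewrite -lerBrDl -ltrBlDl opprK -ler_pdivlMr// -ltr_pdivrMr//.
    by rewrite h1 h2.
  by exists t => //; rewrite inE; apply/asboolP; exists x.
have A0 : A != finset.set0.
  by have [t At _] := cover _ Kx0; apply/set0Pn; exists t.
have volK : (lam m [set t | K (row_of_tuple t)] <= (#|A|%:R * eps ^+ m)%:E)%E.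
  pose cell (t : m.-tuple 'I_N) :=
    [set x : m.-tuple RT | in_cell (- b) eps t (rV_entry (row_of_tuple x))].
  have cellP t := @lebesgue_grid_cell R N (- b) eps m t eps0.
  have sub : (lam m [set t | K (row_of_tuple t)] <=
      \sum_(t \in [set` enum A]) lam m (cell t))%E.
    apply: content_sub_fsum.
    - exact: finite_seq.
    - by move=> t _; have [] := cellP t.
    - apply: closed_measurable_tuple; exact: compact_closed.
    - move=> x /= /cover[t At tx]; exists t => //=.
      by rewrite mem_enum.
  apply: (le_trans sub).
  rewrite -fsbig_seq ?enum_uniq// big_enum /=.
  under eq_bigr => t _ do rewrite (cellP t).2.
  by rewrite sumEFin sumr_const mulr_natl.
have := grid_projection_ge thth Wth WW (lo := - b) eps0 A0
  (h := fun t => (\1_(thickening (compressed W K) e) t)%:E).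
rewrite integral_indic ?setIT//; last exact: measurable_thickening.
move=> main; apply: le_trans (main _ _ _).
- have Kfin : lam m [set t | K (row_of_tuple t)] \is a fin_num.
    by rewrite ge0_fin_numE// (le_lt_trans volK)// ltry.
  rewrite -(fineK Kfin) -EFin_expe lee_fin lerXn2r ?nnegrE ?fine_ge0//.
    by rewrite mulr_ge0// exprn_ge0// ltW.
  by rewrite -lee_fin fineK.
- by apply/measurable_EFinP; apply: measurable_indic; exact: measurable_thickening.
- by move=> t; rewrite lee_fin.
move=> X AX.
have near i : exists x : 'rV[R]_m, K x /\
    forall k : 'I_m, `|rV_entry x k - X i k| < eps.
  have [t] := AX i; rewrite inE => /asboolP[x Kx tx] tX; exists x; split => // k.
  have := tx k; have := tX k; rewrite -natr1 mulrDl mul1r.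
  move=> /andP[h1 h2] /andP[h3 h4]; rewrite ltr_norml; apply/andP; split; lra.
have [x xP] := choice near.
rewrite indicE mem_set//=.
exists (row_of_tuple (compress W m (fun i => rV_entry (x i)))).
  by exists x => // i; have [] := xP i.
split => // i q; rewrite !mxE.
have [k [j qE]] := ord_mul_eq q.
rewrite !(tnth_compress _ _ qE) /ball /= -sumrB.
apply: le_lt_trans (Weps j); apply: le_trans (ler_norm_sum _ _ _) _.
rewrite mulr_sumr; apply: ler_sum => l _; rewrite -mulrBl normrM.
by apply: ler_wpM2r => //; apply: ltW; have [_ ] := xP l.
Qed.

Lemma lebesgue_thickening_lty k (A : set 'rV[R]_k) (e : R) : compact A ->
  (lam k (thickening A e) < +oo)%E.
Proof.
move=> /compact_rV_bounded[b b0 Ab].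
pose B : set RT := `[- (b + e), b + e]%classic.
have mB : measurable B by exact: measurable_itv.
have mbox : measurable [set t : k.-tuple RT | forall i : 'I_k, B (tnth t i)].
  exact: (measurable_tuple_box (A := fun=> B)).
apply: (@le_lt_trans _ _ (lam k [set t | forall i : 'I_k, B (tnth t i)])).
  apply: le_measure; rewrite ?inE //; first exact: measurable_thickening.
  move=> t [w Aw [_ wt]] i; have := wt ord0 i; rewrite mxE /ball /= => wti.
  have := Ab w Aw i; rewrite /B /= in_itv/= -ler_norml => wb.
  rewrite -(subKr (w ord0 i) (tnth t i)).
  by rewrite (le_trans (ler_normB _ _))// lerD// ltW.
have [r Br] : exists r, lebesgue_measure B = r%:E.
  rewrite /B lebesgue_measure_itv/=; case: ifP => _; last by exists 0.
  by exists (b + e - - (b + e)); rewrite EFinB.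
rewrite (lebesgue_tuple_box (A := fun=> B))//.
by under eq_bigr do rewrite Br; rewrite prodEFin ltry.
Qed.

(** A closed set is the intersection of its neighbourhoods of radius 1/(j + 1). These have finite
    measure, so continuity from above carries the bound to the limit. *)
Lemma compressed_volume_ge m (K : set 'rV[R]_m) : compact K -> K !=set0 ->
  (lam m [set t | K (row_of_tuple t)] ^+ d <=
   lam (m * d) [set t | compressed W K (row_of_tuple t)])%E.
Proof.
move=> cK K0; have cC : compact (compressed W K) by exact: compact_compressed.
have clC : closed (compressed W K) by exact: compact_closed.
pose F j := thickening (compressed W K) j.+1%:R^-1.
have capF : \bigcap_j F j = [set t | compressed W K (row_of_tuple t)].
  apply/seteqP; split => [t Ft|t Ct j _]; last first.
    by exists (row_of_tuple t) => //; exact: ballxx.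
  apply: clC => U /nbhs_ballP[r /= r0 rU].
  have /ltr_add_invr[j] := r0; rewrite add0r => jr.
  have [w Cw wt] := Ft j I; exists w; split => //; apply: rU.
  by apply: (le_ball (ltW jr)); exact: ball_sym.
rewrite -capF.
have Fcvg : lam (m * d) \o F @ \oo --> lam (m * d) (\bigcap_j F j).
  apply: nonincreasing_cvg_mu.
  - exact: lebesgue_thickening_lty.
  - by move=> j; exact: measurable_thickening.
  - by rewrite capF; exact: closed_measurable_tuple.
  - move=> i j ij; apply/subsetPset => t [w Cw wt]; exists w => //.
    by apply: le_ball wt; rewrite lef_pV2 ?posrE// ler_nat.
rewrite -(cvg_lim _ Fcvg)//; apply: lime_ge; first by apply/cvg_ex; eexists; exact: Fcvg.
by apply: nearW => j; exact: lebesgue_thickening_ge.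
Qed.

End compressed_volume.

(** * Orthonormal coordinates on the hyperplane *)

Section frames.
Context {R : realType}.
Local Notation RT := (measurableTypeR R).
Local Notation lam k := (@lebesgue_tuple R k).

Lemma lebesgue_orthogonal_preimage k (M : 'M[R]_k) (A : set (k.-tuple RT)) :
  M *m M^T = 1%:M -> measurable A -> lam k (affine M 0 @^-1` A) = lam k A.
Proof.
move=> MM mA.
have dM := normr_det_orthogonal MM.
have uM : M \in unitmx by rewrite unitmxE unitfE -normr_eq0 dM oner_eq0.
have mf : measurable_fun [set: k.-tuple RT] (fun t => (\1_A t)%:E : \bar R).
  by apply/measurable_EFinP; exact: measurable_indic.
have f0 (t : k.-tuple RT) : (0 <= (\1_A t)%:E :> \bar R)%E by rewrite lee_fin.
have := rescales_unitmx uM 0 mf f0.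
rewrite dM invr1 mul1e [X in _ = X -> _]integral_indic// setIT => <-.
rewrite -[X in lam k X]setIT -(integral_indic (lam k) measurableT)//.
by rewrite -[X in measurable X]setTI; exact: measurable_affine.
Qed.

Lemma inner_frame n m k (e : 'I_k -> 'M[R]_(n, m)) (x y : 'rV[R]_k) :
  (forall a b, inner (e a) (e b) = (a == b)%:R) ->
  inner (frame e x) (frame e y) = \sum_a x ord0 a * y ord0 a.
Proof.
move=> ee; rewrite innerE /frame mulmx_suml linear_sum /=; apply: eq_bigr => a _.
rewrite -scalemxAl linearZ /= [X in _ * X](_ : _ = y ord0 a)//.
rewrite linear_sum /= mulmx_sumr linear_sum /= (bigD1 a)//= big1 ?addr0.
  by rewrite linearZ /= -scalemxAr linearZ /= -innerE ee eqxx mulr1.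
by move=> b ba; rewrite linearZ /= -scalemxAr linearZ /= -innerE ee eq_sym (negbTE ba) mulr0.
Qed.

Lemma frame_mulmx n m k l (e : 'I_k -> 'M[R]_(n, m)) (x : 'rV[R]_l) (O : 'M[R]_(l, k)) :
  frame e (x *m O) = \sum_q x ord0 q *: frame e (row q O).
Proof.
rewrite /frame; under [RHS]eq_bigr do rewrite scaler_sumr.
rewrite exchange_big /=; apply: eq_bigr => a _.
rewrite mxE scaler_suml; apply: eq_bigr => q _.
by rewrite mxE scalerA.
Qed.

Lemma ord_mul_lt m d (k : 'I_m) (j : 'I_d) : (k * d + j < m * d)%N.
Proof.
rewrite (@leq_trans (k.+1 * d)) ?leq_mul2r ?ltn_ord ?orbT//.
by rewrite mulSn addnC ltn_add2r.
Qed.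
(** The position in [compress] of the j-th entry of the k-th column. *)
Definition ord_mul m d (k : 'I_m) (j : 'I_d) := Ordinal (ord_mul_lt k j).

Lemma big_ord_mul m d (F : 'I_(m * d) -> R) :
  \sum_q F q = \sum_(j < d) \sum_(k < m) F (ord_mul k j).
Proof.
rewrite pair_bigA /= (reindex (fun p : 'I_d * 'I_m => ord_mul p.2 p.1))//=.
have inv (q : 'I_(m * d)) : exists p : 'I_d * 'I_m, ord_mul p.2 p.1 = q.
  by have [k [j qE]] := ord_mul_eq q; exists (j, k); exact: val_inj.
have [g gK] := choice inv.
apply: onW_bij; exists g => // -[j' k'] /=.
have := congr1 val (gK (ord_mul k' j')); case: (g _) => j k /= kj.
have d0 : (0 < d)%N by exact: leq_ltn_trans (ltn_ord j).
have kk : k = k' :> nat.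
  by have := congr1 (divn^~ d) kj; rewrite /= !divnMDl// !divn_small// !addn0.
by congr pair; apply: val_inj => //; apply/eqP; rewrite -(eqn_add2l (k * d)) kj kk.
Qed.

End frames.

Section projection.
Context {R : realType}.
Local Notation RT := (measurableTypeR R).
Local Notation lam k := (@lebesgue_tuple R k).
Variables (d : nat) (th : 'rV[R]_(1 + d)) (W : 'M[R]_(d, 1 + d)).
Hypothesis thth : th *m th^T = 1%:M.
Hypothesis Wth : W *m th^T = 0.
Hypothesis WW : W *m W^T = 1%:M.
Local Notation n := (1 + d)%N.

(** The linear isometry from R^(m d) onto H_theta that undoes the column by column reading of
    [compress]. *)
Definition embed m (w : 'rV[R]_(m * d)) : 'M[R]_(n, m) :=
  W^T *m (\matrix_(j < d, k < m) w ord0 (ord_mul k j)).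

Lemma inner_embed m (x y : 'rV[R]_(m * d)) :
  inner (embed x) (embed y) = \sum_q x ord0 q * y ord0 q.
Proof.
rewrite innerE /embed trmx_mul trmxK mxtrace_mulC -mulmxA (mulmxA W) WW mul1mx.
rewrite mxtrace_mulC -innerE big_ord_mul; apply: eq_bigr => j _; apply: eq_bigr => k _.
by rewrite !mxE.
Qed.

Lemma embedB m (x y : 'rV[R]_(m * d)) : embed (x - y) = embed x - embed y.
Proof. by rewrite -mulmxBr; congr (_ *m _); apply/matrixP => j k; rewrite !mxE. Qed.

Lemma embedE m (x : 'rV[R]_(m * d)) :
  embed x = \sum_q x ord0 q *: embed (delta_mx 0 q).
Proof.
rewrite /embed; under eq_bigr do rewrite scalemxAr; rewrite -mulmx_sumr.
congr (_ *m _); apply/matrixP => j k; rewrite !mxE summxE (bigD1 (ord_mul k j))//=.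
rewrite !mxE !eqxx mulr1 big1 ?addr0// => q; rewrite eq_sym => /negbTE qkj.
by rewrite !mxE eqxx qkj mulr0.
Qed.

Lemma embed_inj m : injective (@embed m).
Proof.
move=> x y xy; apply/eqP; rewrite -subr_eq0; apply/eqP/(@inner_eq0 _ _ _ (x - y)).
rewrite /inner big_ord1 -inner_embed embedB xy subrr.
by rewrite innerE mul0mx mxtrace0.
Qed.

Lemma embed_Hsub m (w : 'rV[R]_(m * d)) : Hsub th (embed w).
Proof.
apply/HsubE; rewrite /embed mulmxA.
by rewrite (mulmx_tr_eq0 Wth) mul0mx.
Qed.

(** Both sides are W^T W X, since I - theta^T theta = W^T W. *)
Lemma embed_compress m (X : 'M[R]_(n, m)) :
  embed (row_of_tuple (compress W m (fun i => rV_entry (row i X)))) =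
  X - th^T *m (th *m X).
Proof.
have -> : X - th^T *m (th *m X) = W^T *m (W *m X).
  rewrite -{1}[X]mul1mx -(orthonormal_resolution thth Wth WW) mulmxDl -!mulmxA.
  by rewrite addrAC subrr add0r.
congr (_ *m _); apply/matrixP => j k; rewrite !mxE.
rewrite (@tnth_compress _ _ _ _ _ _ k j)//.
by apply: eq_bigr => i _; rewrite rV_entryE mxE mulrC.
Qed.

(** [lebesgue_subspace] uses an unspecified orthonormal basis [e], while [compressed] uses the one
    behind [embed]. The matrix [O] between the two is orthogonal, hence preserves Lebesgue
    measure. *)
Lemma lebesgue_subspace_orthoproj m (K : set 'rV[R]_m) :
  enorm th = 1 -> compact K ->
  lebesgue_subspace (m * d) (Hsub th)
     [set orthoproj (Hsub th) X | X in cartesian_power K] =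
  lam (m * d) [set t | compressed W K (row_of_tuple t)].
Proof.
move=> th1 cK; rewrite /lebesgue_subspace.
set e := xget _ _; have [ee He] : orthonormal_basis (Hsub th) e.
  have [e0 he0] := @orthonormal_basis_Hsub R n m th th1.
  exact: (xgetI _ he0).
have exO q : exists v : 'rV[R]_(m * d), frame e v = embed (delta_mx 0 q).
  have : Hsub th (embed (delta_mx 0 q : 'rV[R]_(m * d))) by exact: embed_Hsub.
  by rewrite He => -[v _ vE]; exists v.
have [f fE] := choice exO.
pose O : 'M[R]_(m * d) := \matrix_q f q.
have OE (w : 'rV[R]_(m * d)) : frame e (w *m O) = embed w.
  by rewrite frame_mulmx embedE; apply: eq_bigr => q _; rewrite rowK fE.
have OO : O *m O^T = 1%:M.
  apply/matrixP => q q'; rewrite !mxE.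
  transitivity (inner (frame e (f q)) (frame e (f q'))).
    by rewrite inner_frame//; apply: eq_bigr => a _; rewrite !mxE.
  rewrite !fE inner_embed (bigD1 q)//= big1 ?addr0.
    by rewrite !mxE !eqxx mul1r.
  by move=> p; rewrite !mxE eqxx => /negbTE ->; rewrite mul0r.
have OTO := mulmx1C OO.
have mC : measurable [set t : (m * d).-tuple RT | compressed W K (row_of_tuple t)].
  by apply: closed_measurable_tuple; apply: compact_closed => //; exact: compact_compressed.
rewrite -[RHS](@lebesgue_orthogonal_preimage _ _ O^T) ?trmxK//.
rewrite /lebesgue_rV; congr (lam _ _); apply/seteqP; split => t /=.
  move=> [X KX XE]; rewrite tuple_of_rowK addr0.
  exists (fun i => row i X) => //; apply: (@embed_inj m).
  rewrite embed_compress -orthoproj_Hsub// XE -OE -mulmxA OTO mulmx1.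
  by [].
rewrite tuple_of_rowK addr0 => -[X KX XE].
exists (\matrix_i X i); first by move=> i; rewrite rowK.
rewrite orthoproj_Hsub// -embed_compress.
under eq_fun do rewrite rowK.
by rewrite -XE -OE -mulmxA OTO mulmx1.
Qed.

End projection.

Theorem proposition2 (R : realType) (m n : nat) (K : set 'rV[R]_m)
    (K_compact : compact K) (K_symmetric : [set - x | x in K] = K)
    (K_nonempty : n = 1%N -> K !=set0)
    (theta : 'rV[R]_n) (theta_unit : enorm theta = 1) :
  (lebesgue_rV K ^+ n.-1 <=
   lebesgue_subspace (m * n.-1) (Hsub theta)
     [set orthoproj (Hsub theta) X | X in cartesian_power K])%E.
Proof.
have := enorm1P theta_unit.
case: n theta theta_unit K_nonempty => [|d] theta theta_unit K_nonempty thth.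
  have := congr1 (fun M : 'M[R]_1 => M ord0 ord0) thth.
  by rewrite !mxE big_ord0 => /eqP; rewrite eq_sym oner_eq0.
(* The rows of [Q] after the first, which is theta, form the orthonormal basis [W] of theta^perp. *)
have [Q QQ Q0] := orthogonal_completion thth.
pose W : 'M[R]_(d, d.+1) := row' ord0 Q.
have WW : W *m W^T = 1%:M.
  apply/matrixP => i j; have /matrixP/(_ (lift ord0 i) (lift ord0 j)) := QQ.
  rewrite !mxE (inj_eq lift_inj) => <-.
  by apply: eq_bigr => k _; rewrite !mxE.
have Wth : W *m theta^T = 0.
  apply/matrixP => i j; transitivity ((Q *m Q^T) (lift ord0 i) ord0).
    by rewrite -Q0 !mxE; apply: eq_bigr => k _; rewrite !mxE.
  by rewrite QQ !mxE.
rewrite /= (lebesgue_subspace_orthoproj thth Wth WW theta_unit)//.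
(* For empty K and n > 1 the left side is a positive power of 0. For n = 1 it would be the zeroth
   power, equal to 1, and [K_nonempty] excludes this case. *)
have [K0|/set0P K0] := eqVneq K set0; last exact: (compressed_volume_ge thth Wth WW).
case: d => [|d] in theta theta_unit K_nonempty thth Q QQ Q0 W WW Wth *.
  by have := K_nonempty erefl; rewrite K0 => -[].
rewrite [lebesgue_rV K](_ : _ = 0)%E.
  rewrite (_ : (0 ^+ d.+1)%E = 0%E)//.
  by rewrite -[0%E]/(0%:E) -EFin_expe expr0n.
rewrite K0; exact: measure0.
Qed.
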